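(* Let $(\mathcal{S},\mathcal{A},p_{\mathrm{tr}},d_{\varnothing},\gamma)$ be a finite discounted MDP with $\gamma\in[0,1)$, let $\mathcal{R}$ be a probability distribution over reward functions $\mathcal{S}\times\mathcal{A}\times\mathcal{S}\to[-U,U]$, let $1\le k\le N$ and $T\ge1$ be integers, and let $(\pi^t)_{t=1}^T$ be the random sequence of stationary policies generated by $k$-of-$N$ CFR with per-state regret bound $C^T$. Let $p\in(0,1]$ and $$\varepsilon^T=\frac{C^T}{(1-\gamma)T}+4U\sqrt{\frac{2\log(1/p)}{T}}.$$ Then: (i) with probability at least $1-p$, the best policy in the sequence $(\pi^t)_{t=1}^T$ (one maximizing $J$ over $\pi^1,\dots,\pi^T$, where $J(\pi)=\mathbb{E}_{\bar r\sim\mu_{k\text{-of-}N}(\cdot;\pi)}[v_{\varnothing}(\pi;\bar r)]$) is an $\varepsilon^T$-approximation to a $\mu_{k\text{-of-}N}$-robust policy; (ii) for every $q\in(0,1]$, with probability at least $(1-p)(1-q)$, a policy sampled uniformly at random from the sequence $(\pi^t)_{t=1}^T$ is an $(\varepsilon^T/q)$-approximation to a $\mu_{k\text{-of-}N}$-robust policy.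
   Context: MDP. $\mathcal{S}$ is a finite set of states, $\mathcal{A}$ a finite set of actions, $p_{\mathrm{tr}}(\cdot\mid s,a)$ a probability distribution on $\mathcal{S}$ for each $(s,a)$ (Markovian transitions), $d_{\varnothing}$ an initial state distribution on $\mathcal{S}$, $\gamma\in[0,1)$ a discount factor. The transition probabilities and initial distribution are fixed and known; only the reward function is uncertain. A reward function is a map $r:\mathcal{S}\times\mathcal{A}\times\mathcal{S}\to[-U,U]$. A stationary policy $\pi$ assigns to each state $s$ a probability distribution $\pi(\cdot\mid s)$ on $\mathcal{A}$. Returns (normalized by $1-\gamma$). With $A_i\sim\pi(\cdot\mid S_{i-1})$ and $S_i\sim p_{\mathrm{tr}}(\cdot\mid S_{i-1},A_i)$ for $i\ge1$: $v_{\varnothing}(\pi;r)=(1-\gamma)\,\mathbb{E}\bigl[\sum_{i=0}^\infty\gamma^i r(S_i,A_{i+1},S_{i+1})\bigr]$ with $S_0\sim d_{\varnothing}$; $q_s(a,\pi;r)=(1-\gamma)\,\mathbb{E}\bigl[\sum_{i=0}^\infty\gamma^i r(S_i,A_{i+1},S_{i+1})\mid S_0=s,A_1=a\bigr]$ (take $a$ first, follow $\pi$ afterwards); $v_s(\pi;r)=\mathbb{E}_{A\sim\pi(\cdot\mid s)}[q_s(A,\pi;r)]$; advantage $\rho_s(a,\pi;r)=q_s(a,\pi;r)-v_s(\pi;r)$. CFR. Given reward functions $r^1,r^2,\dots$ revealed one at a time, CFR deterministically produces stationary policies $\pi^1,\pi^2,\dots$, where $\pi^t$ depends only on $r^1,\dots,r^{t-1}$,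 by running a no-regret learner at each state $s$, which generates $\pi^t(\cdot\mid s)$ and then learns from $q_s(\cdot,\pi^t;r^t)$. Its defining property is that, for every sequence of reward functions (possibly chosen adaptively, with $r^t$ depending on $\pi^t$), $\sum_{t=1}^T\rho_s(a,\pi^t;r^t)\le C^T$ for all $s\in\mathcal{S}$, $a\in\mathcal{A}$, where $C^T\in o(T)$ is a deterministic bound depending on the learner used. $k$-of-$N$ distribution. For a stationary policy $\pi$, $\mu_{k\text{-of-}N}(\cdot;\pi)$ is the distribution of the random reward function $\bar r=\frac1k\sum_{j=1}^k r_{(j)}$, where $r_1,\dots,r_N$ are drawn i.i.d. from $\mathcal{R}$ and $r_{(1)},\dots,r_{(N)}$ is their reordering by increasing value of $v_{\varnothing}(\pi;\cdot)$ (so $r_{(1)},\dots,r_{(k)}$ are the $k$ worst for $\pi$; ties broken by a fixed rule). $k$-of-$N$ CFR. On iteration $t$, given the current policy $\pi^t$, sample $N$ fresh reward functions i.i.d. from $\mathcal{R}$ independently of the past, form $\bar r^t$ as the average of the $k$ worst ones for $\pi^t$ (so that, given the past, $\bar r^t\sim\mu_{k\text{-of-}N}(\cdot;\pi^t)$), and feed $r^t:=\bar r^t$ to CFR to obtain $\pi^{t+1}$. Robust policies. A $\mu_{k\text{-of-}N}$-robust policy is a stationary policy maximizing $J(\pi)=\mathbb{E}_{\bar r\sim\mu_{k\text{-of-}N}(\cdot;\pi)}[v_{\varnothing}(\pi;\bar r)]$ over all stationary policies; let $v^*_{\varnothing}=\max_\pi J(\pi)$. A stationary policy $\hat\pi$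 is an $\varepsilon$-approximation to a $\mu_{k\text{-of-}N}$-robust policy if $J(\hat\pi)\ge v^*_{\varnothing}-\varepsilon$. In (ii) the probability is over both the algorithm's sampling and the uniform choice of the index $t\in\{1,\dots,T\}$, which is independent of the algorithm's sampling. *)

(* Defs.v *)
From HB Require Import structures.
From mathcomp Require Import all_boot all_order all_algebra.
From mathcomp Require Import all_classical all_reals all_analysis.

Set Implicit Arguments.
Unset Strict Implicit.
Unset Printing Implicit Defensive.

Import Order.TTheory GRing.Theory Num.Theory.
Import numFieldNormedType.Exports.

Local Open Scope classical_set_scope.
Local Open Scope ring_scope.

Record fdist (R : realType) (X : finType) := FDist {
  fdist_fun :> X -> R ;
  fdist_ge0 : forall x, 0 <= fdist_fun x ;
  fdist_sum1 : \sum_x fdist_fun x = 1 }.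

(* Functions I -> R, with the product sigma-algebra (for a finite I, the Borel
   sigma-algebra of the finite-dimensional space R^I). *)
Section function_space.
Variables (R : realType) (I : finType).

Definition cylinders : set (set (I -> R)) :=
  [set C | exists (i : I) (B : set R), measurable B /\ C = [set f | B (f i)]].

Definition fun_space : measurableType cylinders.-sigma :=
  g_sigma_algebraType cylinders.

End function_space.

(* The law of n i.i.d. draws from Q. *)
Section iid_law.
Context d (X : measurableType d) (R : realType).

Definition tuple_cons n (x : X * n.-tuple X) : n.+1.-tuple X :=
  [tuple of x.1 :: x.2].

Lemma measurable_tuple_cons n : measurable_fun setT (@tuple_cons n).
Proof.
by apply: measurable_cons; [exact: measurable_fst|exact: measurable_snd].
Qed.

HB.instance Definition _ n :=
  isMeasurableFun.Build _ _ _ _ (@tuple_cons n) (@measurable_tuple_cons n).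

Fixpoint iid_law (Q : probability X R) n : probability (n.-tuple X) R :=
  match n return probability (n.-tuple X) R with
  | 0 => \d_([tuple])
  | n'.+1 => distribution (Q \x iid_law Q n')%E (@tuple_cons n')
  end.

End iid_law.

Record mdp (R : realType) (S A : finType) := MDP {
  ptr : S -> A -> fdist R S ;
  init : fdist R S ;
  gamma : R ;
  gamma_range : 0 <= gamma < 1 }.

Section returns.
Variables (R : realType) (S A : finType) (M : mdp R S A).

Definition policy := S -> fdist R A.

Definition reward : measurableType _ := fun_space R (S * A * S)%type.

Definition reward_bounded (U : R) : set reward :=
  [set r : reward | forall x, `|r x| <= U].

Local Notation gam := (gamma M).

(* [St i] is the state S_i and [Ac i] is the action A_(i+1) taken in it, so
   that the reward at time i is r (S_i, A_(i+1), S_(i+1)).  The pair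
   (S_0, A_1) has law [mu]; from then on S_(i+1) ~ p_tr(. | S_i, A_(i+1)) and
   A_(i+1) ~ pi(. | S_i). *)
Definition is_trajectory (pi : policy) (mu : S -> A -> R)
    d (Om : measurableType d) (P : probability Om R)
    (St : nat -> Om -> S) (Ac : nat -> Om -> A) : Prop :=
  [/\ forall i s, measurable [set w | St i w = s],
      forall i a, measurable [set w | Ac i w = a] &
      forall n (s : nat -> S) (a : nat -> A),
        P [set w | forall i, (i <= n)%N -> St i w = s i /\ Ac i w = a i] =
        (mu (s 0%N) (a 0%N) *
         \prod_(i < n) (ptr M (s i) (a i) (s i.+1) * pi (s i.+1) (a i.+1)))%:E].

Definition discounted_sum (r : reward) d (Om : measurableType d)
    (St : nat -> Om -> S) (Ac : nat -> Om -> A) (w : Om) : R :=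
  limn [series gam ^+ i * r (St i w, Ac i w, St i.+1 w)]_i.

Definition is_expected_return (pi : policy) (mu : S -> A -> R) (r : reward)
    (v : R) : Prop :=
  exists d (Om : measurableType d) (P : probability Om R)
         (St : nat -> Om -> S) (Ac : nat -> Om -> A),
    is_trajectory pi mu P St Ac /\
    v = (1 - gam) * fine 'E_P[discounted_sum r St Ac].

(* When [mu] is a probability distribution, the trajectory process exists
   (Ionescu-Tulcea) and its law determines the expectation, so there is exactly
   one [v] to pick. *)
Definition expected_return (pi : policy) (mu : S -> A -> R) (r : reward) : R :=
  xget 0 [set v | is_expected_return pi mu r v].

Definition v0 (pi : policy) (r : reward) : R :=
  expected_return pi (fun s a => init M s * pi s a) r.

Definition qval (pi : policy) (r : reward) (s : S) : fun_space R A :=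
  fun a => expected_return pi (fun s' a' => ((s', a') == (s, a))%:R) r.

Definition vval (pi : policy) (r : reward) (s : S) : R :=
  \sum_a pi s a * qval pi r s a.

Definition advantage (pi : policy) (r : reward) (s : S) (a : A) : R :=
  qval pi r s a - vval pi r s.

End returns.

Section cfr.
Variables (R : realType) (S A : finType) (M : mdp R S A).

(* At each state, a learner maps the sequence of payoff vectors seen so far to
   the next distribution on actions. *)
Definition learners := S -> seq (fun_space R A) -> fdist R A.

(* Needed for the policies computed from random reward functions to be random
   variables. *)
Definition measurable_learners (L : learners) : Prop :=
  forall (s : S) (a : A) (n : nat),
    measurable_fun setT (fun x : n.-tuple (fun_space R A) => L s x a : R).

(* An environment reveals, at iteration [t], a reward function that may depend
   on the current policy. *)
Definition environment := nat -> policy R S A -> reward R S A.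

Fixpoint cfr_history (L : learners) (e : environment) (t : nat) :
    S -> seq (fun_space R A) :=
  match t with
  | 0 => fun=> [::]
  | t'.+1 => fun s =>
      let h := cfr_history L e t' in
      let pi : policy R S A := fun s' => L s' (h s') in
      rcons (h s) (qval M pi (e t' pi) s)
  end.

(* Iterations are numbered from 0: [cfr L e t] is pi^(t+1). *)
Definition cfr (L : learners) (e : environment) (t : nat) : policy R S A :=
  fun s => L s (cfr_history L e t s).

Definition cfr_regret_bound (U : R) (L : learners) (C : nat -> R) : Prop :=
  C =o_\oo (fun T : nat => T%:R : R) /\
  forall e : environment, (forall t pi, reward_bounded U (e t pi)) ->
  forall T : nat, (0 < T)%N -> forall (s : S) (a : A),
    \sum_(t < T) advantage M (cfr L e t) (e t (cfr L e t)) s a <= C T.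

End cfr.

Section k_of_N.
Variables (R : realType) (S A : finType) (M : mdp R S A).
Variables (Rw : probability (reward R S A) R) (k N : nat).

(* [sort] is stable, so ties are broken in favour of the smallest index. *)
Definition kworst_avg (pi : policy R S A) (rs : N.-tuple (reward R S A)) :
    reward R S A :=
  fun x => k%:R^-1 *
    \sum_(r <- take k (sort (fun r1 r2 => v0 M pi r1 <= v0 M pi r2) rs)) r x.

Definition mu_kN (pi : policy R S A) : set (reward R S A) -> \bar R :=
  pushforward (iid_law Rw N) (kworst_avg pi).

Definition Jval (pi : policy R S A) : R :=
  fine (\int[mu_kN pi]_r (v0 M pi r)%:E).

(* The maximum of J: J is continuous on the compact set of stationary policies, so the
   supremum is attained. *)
Definition v_star : R := sup [set Jval pi | pi in [set: policy R S A]].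

Definition approx_robust (eps : R) (pi : policy R S A) : Prop :=
  v_star - eps <= Jval pi.

(* [X t] is the batch of N reward functions drawn at iteration [t]. *)
Definition kN_cfr (L : learners R S A) (X : nat -> N.-tuple (reward R S A))
    (t : nat) : policy R S A :=
  cfr M L (fun t' pi => kworst_avg pi (X t')) t.

End k_of_N.

Section sampling.
Variables (R : realType) (S A : finType).
Variables (Rw : probability (reward R S A) R) (N T : nat).
Context d (Om : measurableType d) (P : probability Om R).
Variable X : nat -> Om -> N.-tuple (reward R S A).

Definition sample_event (B : 'I_T -> 'I_N -> set (reward R S A)) : set Om :=
  [set w | forall t j, B t j (tnth (X t w) j)].

(* The T * N draws of the first T iterations are i.i.d. with law [Rw]. *)
Definition iid_samples : Prop :=
  (forall (t : 'I_T) (j : 'I_N), measurable_fun setT (fun w => tnth (X t w) j))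
  /\
  forall B : 'I_T -> 'I_N -> set (reward R S A),
    (forall t j, measurable (B t j)) ->
    P (sample_event B) = (\prod_(t < T) \prod_(j < N) Rw (B t j))%E.

Definition independent_uniform_index (tau : Om -> 'I_T) : Prop :=
  [/\ forall i, measurable [set w | tau w = i],
      forall i, P [set w | tau w = i] = (T%:R^-1)%:E &
      forall i (B : 'I_T -> 'I_N -> set (reward R S A)),
        (forall t j, measurable (B t j)) ->
        P ([set w | tau w = i] `&` sample_event B) =
        (P [set w | tau w = i]%classic * P (sample_event B))%E].

Definition with_prob_ge (c : R) (E : set Om) : Prop :=
  measurable E /\ (c%:E <= P E)%E.

End sampling.

Definition eps_bound (R : realType) (gam U p CT : R) (T : nat) : R :=
  CT / ((1 - gam) * T%:R) + 4 * U * Num.sqrt (2 * ln (1 / p) / T%:R).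

(* Main.v *)
(* Let [D_t] be the return of a fixed policy [pi'] minus that of [pi^t], both
   under the sampled reward of iteration [t].  The per-state regret bounds and
   the Bellman equations give [\sum_t D_t <= C T / (1 - gamma)] on every sample.
   Since the k worst rewards for [pi'] minimize the k-average of its returns, the
   conditional mean of [D_t] is at least [J pi' - J (pi^t)]; hence
   [J pi' - J (pi^t) - D_t] is a supermartingale difference bounded by [4 U],
   and Hoeffding's lemma bounds the moment generating function of the sum.  That
   bound is monotone in [J pi'], so it passes to the supremum [v_star] before
   Markov's inequality is applied, and a maximizer of J is never needed.  Part (i)
   compares the best policy with the average gap, and part (ii) is Markov's
   inequality for the uniform index. *)
Require Import Defs.
From HB Require Import structures.
From mathcomp Require Import all_boot all_order all_algebra.
From mathcomp Require Import all_classical all_reals all_analysis.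
From mathcomp Require Import measurable_realfun.
From mathcomp Require Import ring lra.

Set Implicit Arguments.
Unset Strict Implicit.
Unset Printing Implicit Defensive.

Import Order.TTheory GRing.Theory Num.Theory.
Import numFieldNormedType.Exports.

Local Open Scope classical_set_scope.
Local Open Scope ring_scope.

(** * Discounted values of a finite Markov chain *)

(** Returns are defined by [xget] over all trajectory processes, so nothing can be computed before
    two facts are known: such a process exists (it is built from one uniform variable), and every
    such process yields the solution [disc_value] of the Bellman equation. From there on returns are
    plain algebra. Two mismatches shape the probabilistic part. Rewards are bounded by [U] only
    almost surely while the regret bound asks for bounded environments, so the estimates live on an
    event of full measure and the environment is altered beyond the horizon. And policies depend on
    a growing history: instead of a filtration with conditional expectations, the law of the batches
    is an iterated product, whose first factor is integrated out by Tonelli after being absorbed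
    into the learners. The constant [4 U] counts four quantities bounded by [U]; the factor
    [1 / (1 - gamma)] comes from a Bellman inequality [D <= c + gamma * K D] read at the maximum of
    [D]. *)

Section markov_value.
Variables (R : realType) (X : finType) (K : X -> X -> R) (g : R).
Hypothesis K0 : forall x y, 0 <= K x y.
Hypothesis K1 : forall x, \sum_y K x y = 1.
Hypothesis g01 : 0 <= g < 1.

Let g0 : 0 <= g. Proof. by case/andP: g01. Qed.
Let g1 : 0 < 1 - g. Proof. by rewrite subr_gt0; case/andP: g01. Qed.

Lemma stochastic_sum_le (f : X -> R) (b : R) x :
  (forall y, f y <= b) -> \sum_y K x y * f y <= b.
Proof.
move=> fb; rewrite -[leRHS]mul1r -(K1 x) mulr_suml.
by apply: ler_sum => y _; exact: ler_wpM2l.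
Qed.

(* At a maximizer [x] of [f] the hypothesis reads [f x <= c + g * f x]. *)
Lemma discounted_max_le (f : X -> R) (c : R) :
  (forall x, f x <= c + g * \sum_y K x y * f y) ->
  forall x, f x <= c / (1 - g).
Proof.
move=> hf x.
have [i _ hi] : {i : X | true & forall j, true -> f j <= f i}.
  by case: (@arg_maxP _ _ X x xpredT f isT) => i _ hi; exists i.
apply: le_trans (hi x isT) _; rewrite ler_pdivlMr//.
have h : \sum_y K i y * f y <= f i by apply: stochastic_sum_le => y; exact: hi.
have := hf i; have := ler_wpM2l g0 h; lra.
Qed.

Definition avg_step (f : X -> R) (x : X) : R := \sum_y K x y * f y.

Definition disc_partial (f : X -> R) (x : X) : R^nat :=
  series (fun i => g ^+ i * iter i avg_step f x).

Definition disc_value (f : X -> R) (x : X) : R :=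
  (1 - g) * limn (disc_partial f x).

Lemma iter_avg_step_le (f : X -> R) (b : R) :
  (forall x, `|f x| <= b) -> forall i x, `|iter i avg_step f x| <= b.
Proof.
move=> fb; elim=> [|i IH] x //=.
apply: le_trans (ler_norm_sum _ _ _) _.
rewrite (eq_bigr (fun y => K x y * `|iter i avg_step f y|)); last first.
  by move=> y _; rewrite normrM ger0_norm.
exact: stochastic_sum_le.
Qed.

Lemma is_cvg_disc_partial (f : X -> R) x : cvgn (disc_partial f x).
Proof.
have [b fb] : exists b, forall x, `|f x| <= b.
  exists (\sum_y `|f y|) => y; rewrite (bigD1 y)//= lerDl.
  exact: sumr_ge0.
apply: normed_cvg.
have := @is_cvg_geometric_series R b g.
rewrite ger0_norm// => /(_ _)/wrap[]; first by case/andP: g01.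
apply: series_le_cvg => n /=.
- exact: normr_ge0.
- by rewrite mulr_ge0 ?exprn_ge0// (le_trans _ (fb x)).
- rewrite normrM ger0_norm ?exprn_ge0// mulrC ler_wpM2r ?exprn_ge0//.
  exact: iter_avg_step_le.
Qed.

(** Isolating the first reward gives a recursion that serves twice: its limit is the Bellman
    equation, and induction on [n] along it gives measurability in the policy. *)
Lemma disc_partialS (f : X -> R) x n :
  disc_partial f x n.+1 = f x + g * \sum_y K x y * disc_partial f y n.
Proof.
rewrite /disc_partial /series /= big_nat_recl//= expr0 mul1r; congr (_ + _).
under [in RHS]eq_bigr do rewrite mulr_sumr.
rewrite exchange_big /= mulr_sumr; apply: eq_bigr => i _.
rewrite exprS -mulrA; congr (_ * _); rewrite mulr_sumr.
by apply: eq_bigr => y _; rewrite mulrCA.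
Qed.

Lemma disc_value_bellman (f : X -> R) x :
  disc_value f x = (1 - g) * f x + g * \sum_y K x y * disc_value f y.
Proof.
rewrite /disc_value.
have -> : limn (disc_partial f x) =
    f x + g * \sum_y K x y * limn (disc_partial f y).
  apply/cvg_lim => //; rewrite -(cvg_shiftS (disc_partial f x)).
  rewrite (_ : [sequence _]_n = fun n =>
    f x + g * \sum_y K x y * disc_partial f y n); last first.
    by apply/funext => n /=; rewrite disc_partialS.
  apply: cvgD; first exact: cvg_cst.
  apply: cvgMl_tmp; apply: cvg_big => [|y _]; first exact: add_continuous.
  by apply: cvgMl_tmp; exact: is_cvg_disc_partial.
rewrite mulrDr; congr (_ + _); rewrite mulrCA; congr (_ * _).
by rewrite mulr_sumr; apply: eq_bigr => y _; rewrite mulrCA.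
Qed.

(** The difference of two solutions satisfies [discounted_max_le] with [c = 0], in both directions.
    Linearity in [f] then follows by checking the equation, without handling limits. *)
Lemma disc_value_uniq (f h : X -> R) :
  (forall x, h x = (1 - g) * f x + g * \sum_y K x y * h y) ->
  h =1 disc_value f.
Proof.
move=> hh x; apply/le_anti/andP; split; rewrite -subr_le0.
- rewrite -(mul0r (1 - g)^-1).
  apply: (discounted_max_le (f := fun x => h x - disc_value f x)) => {}x.
  under eq_bigr do rewrite mulrBr.
  by rewrite hh disc_value_bellman sumrB; lra.
- rewrite -(mul0r (1 - g)^-1).
  apply: (discounted_max_le (f := fun x => disc_value f x - h x)) => {}x.
  under eq_bigr do rewrite mulrBr.
  by rewrite hh disc_value_bellman sumrB; lra.
Qed.

Lemma disc_valueZ (c : R) (f : X -> R) x :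
  disc_value (fun y => c * f y) x = c * disc_value f x.
Proof.
apply/esym/(disc_value_uniq (h := fun y => c * disc_value f y)) => {}x.
rewrite disc_value_bellman mulrDr mulrCA; congr (_ + _).
rewrite mulrCA [c * _]mulr_sumr; congr (_ * _).
by apply: eq_bigr => y _; rewrite mulrCA.
Qed.

Lemma disc_value_sum (I : Type) (r : seq I) (F : I -> X -> R) x :
  disc_value (fun y => \sum_(i <- r) F i y) x = \sum_(i <- r) disc_value (F i) x.
Proof.
apply/esym/(disc_value_uniq (h := fun y => \sum_(i <- r) disc_value (F i) y)) => {}x.
under eq_bigr do rewrite disc_value_bellman.
rewrite big_split/= -!mulr_sumr; congr (_ + g * _).
by rewrite exchange_big/=; apply: eq_bigr => y _; rewrite mulr_sumr.
Qed.

(** [discounted_max_le] with [c = (1 - g) * b]: the normalization makes the value an average of [f],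
    so that bounds pass with constant 1. *)
Lemma disc_value_le (f : X -> R) (b : R) :
  (forall x, f x <= b) -> forall x, disc_value f x <= b.
Proof.
move=> fb x; rewrite -[leRHS](mulKf (lt0r_neq0 g1)) mulrC.
apply: (discounted_max_le (f := disc_value f)) => {}x.
by rewrite disc_value_bellman lerD2r ler_wpM2l// ltW.
Qed.

Lemma disc_value_norm_le (f : X -> R) (b : R) :
  (forall x, `|f x| <= b) -> forall x, `|disc_value f x| <= b.
Proof.
move=> fb x; rewrite ler_norml; apply/andP; split; last first.
  by apply: disc_value_le => y; exact: le_trans (ler_norm _) (fb y).
rewrite lerNl -mulN1r -disc_valueZ; apply: disc_value_le => y.
by rewrite mulN1r (le_trans (ler_norm _))// normrN.
Qed.

End markov_value.

(** * A Markov chain on the unit interval *)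

Section inverse_cdf.
Variables (R : realType) (X : eqType) (x0 : X) (f : X -> R).
Hypothesis f0 : forall x, 0 <= f x.

Fixpoint inv_cdf (s : seq X) (u : R) : X :=
  if s is y :: s' then if u < f y then y else inv_cdf s' (u - f y) else x0.

Fixpoint cdf_left (s : seq X) (x : X) : R :=
  if s is y :: s' then if x == y then 0 else f y + cdf_left s' x else 0.

Lemma cdf_left_ge0 s x : 0 <= cdf_left s x.
Proof. by elim: s => //= y s IH; case: eqP => // _; exact: addr_ge0. Qed.

Lemma cdf_left_le s x : x \in s -> cdf_left s x + f x <= \sum_(y <- s) f y.
Proof.
elim: s => //= y s IH; rewrite inE big_cons; case: eqP => [->|_ /= xs].
  by rewrite add0r lerDl sumr_ge0.
by rewrite -addrA lerD2l IH.
Qed.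

(** The half-open intervals starting at [cdf_left s x] with length [f x] tile the range of [u]. A
    point of mass zero owns an empty interval and is never selected. *)
Lemma inv_cdfP s u : uniq s -> 0 <= u < \sum_(y <- s) f y ->
  inv_cdf s u \in s /\
  forall x, x \in s ->
    (inv_cdf s u == x) = (cdf_left s x <= u < cdf_left s x + f x).
Proof.
elim: s u => [|y s IH] u /=.
  by rewrite big_nil => _ /andP[/le_lt_trans h /h]; rewrite ltxx.
move=> /andP[ys us]; rewrite big_cons => /andP[u0 u1].
have [uy|yu] := ltP u (f y).
  rewrite mem_head; split=> // x _; rewrite (eq_sym y); case: eqVneq => [->|_].
    by rewrite u0 add0r uy.
  apply/esym/negbTE; rewrite negb_and -ltNge (lt_le_trans uy)//.
  by rewrite lerDl cdf_left_ge0.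
have [|sin IHs] := IH (u - f y) us.
  by rewrite subr_ge0 yu ltrBlDl.
rewrite inE sin orbT; split=> // x; rewrite inE.
have [->|xy] := eqVneq x y; move=> /= xs.
  rewrite add0r (ltNge u) yu andbF; apply/eqP => e.
  by move: ys; rewrite -e sin.
by rewrite IHs// lerBrDl ltrBlDl addrA.
Qed.

End inverse_cdf.

Section markov_chain.
Variables (R : realType) (X : finType) (mu : X -> R) (K : X -> X -> R).
Hypothesis mu0 : forall x, 0 <= mu x.
Hypothesis mu1 : \sum_x mu x = 1.
Hypothesis K0 : forall x y, 0 <= K x y.
Hypothesis K1 : forall x, \sum_y K x y = 1.
Variable x0 : X.

Let ienum := index_enum X.

Definition split_unit (f : X -> R) (u : R) : X * R :=
  let x := inv_cdf x0 f ienum u in (x, (u - cdf_left f ienum x) / f x).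

(* [u] uniform on [0, 1[ drives the whole chain: the part of [u] left after
   inverting the distribution function of the current state is rescaled to a
   fresh uniform variable. *)
Fixpoint chain (n : nat) (u : R) : X * R :=
  if n is n'.+1 then split_unit (K (chain n' u).1) (chain n' u).2
  else split_unit mu u.

(** Left end and length of the interval of those [u] in [[0, 1[] whose first [n + 1] states are
    [x 0], ..., [x n]; each new state cuts a subinterval out of the previous one. *)
Fixpoint cell (x : nat -> X) (n : nat) : R * R :=
  if n is n'.+1 then
    let c := cell x n' in
    (c.1 + c.2 * cdf_left (K (x n')) ienum (x n), c.2 * K (x n') (x n))
  else (cdf_left mu ienum (x 0%N), mu (x 0%N)).

Lemma cell_len x n :
  (cell x n).2 = mu (x 0%N) * \prod_(i < n) K (x i) (x i.+1).
Proof.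
elim: n => [|n IH] /=; first by rewrite big_ord0 mulr1.
by rewrite big_ord_recr/= IH mulrA.
Qed.

Lemma cell_range x n :
  [/\ 0 <= (cell x n).1, 0 <= (cell x n).2 &
      (cell x n).1 + (cell x n).2 <= 1].
Proof.
elim: n => [|n [IH1 IH2 IH3]] /=.
  split; [exact: cdf_left_ge0|by []|rewrite -mu1].
  by apply: cdf_left_le => //; exact: mem_index_enum.
split; [by rewrite addr_ge0// mulr_ge0// cdf_left_ge0|exact: mulr_ge0|].
rewrite -addrA -mulrDr; apply: le_trans IH3; rewrite lerD2l ler_piMr//.
by rewrite -(K1 (x n)); apply: cdf_left_le => //; exact: mem_index_enum.
Qed.

Lemma split_unitP (f : X -> R) u x :
  (forall x, 0 <= f x) -> \sum_x f x = 1 -> 0 <= u < 1 ->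
  ((split_unit f u).1 == x) =
    (cdf_left f ienum x <= u < cdf_left f ienum x + f x).
Proof.
move=> f0 f1 u01.
have [|_] := @inv_cdfP R X x0 f f0 ienum u (index_enum_uniq X).
  by rewrite f1.
by move/(_ x (mem_index_enum x)).
Qed.

Lemma chain_cell (x : nat -> X) n u : 0 <= u < 1 ->
  (forall i, (i <= n)%N -> (chain i u).1 = x i) <->
  (cell x n).1 <= u < (cell x n).1 + (cell x n).2.
Proof.
move=> u01.
(* The induction must also carry the residual variable: on a cell it is the affine map of that cell
   onto [[0, 1[], which is what the next inversion acts on. *)
suff: ((forall i, (i <= n)%N -> (chain i u).1 = x i) <->
  (cell x n).1 <= u < (cell x n).1 + (cell x n).2) /\
  ((forall i, (i <= n)%N -> (chain i u).1 = x i) ->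
    (chain n u).2 = (u - (cell x n).1) / (cell x n).2) by case.
elim: n => [|n [IH IHu]].
  split.
    rewrite /= -split_unitP//; split=> [/(_ 0%N (leqnn _)) <- //|/eqP h i].
    by rewrite leqn0 => /eqP ->.
  by move/(_ 0%N (leqnn _)) => /= h; rewrite h.
have E : (forall i, (i <= n.+1)%N -> (chain i u).1 = x i) <->
    (forall i, (i <= n)%N -> (chain i u).1 = x i) /\ (chain n.+1 u).1 = x n.+1.
  split=> [h|[h1 h2] i].
    by split=> [i lin|]; apply: h => //; exact: leqW.
  by rewrite leq_eqVlt => /orP[/eqP -> //|]; rewrite ltnS; exact: h1.
have [c1 c2 c3] := cell_range x n.
have kl : cdf_left (K (x n)) ienum (x n.+1) + K (x n) (x n.+1) <= 1.
  by rewrite -(K1 (x n)); apply: cdf_left_le => //; exact: mem_index_enum.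
have kl0 := cdf_left_ge0 (K0 (x n)) ienum (x n.+1).
split.
  rewrite E; split.
    case=> h1 /=; rewrite h1// IHu//.
    have /andP[a b] := IH.1 h1.
    have len0 : 0 < (cell x n).2 by rewrite -(ltrD2l (cell x n).1) addr0 (le_lt_trans a).
    move=> /eqP; rewrite split_unitP//; last first.
      by rewrite divr_ge0 ?subr_ge0//= ltr_pdivrMr// mul1r ltrBlDl.
    rewrite ler_pdivlMr// ltr_pdivrMr// lerBrDr ltrBlDr.
    by case/andP => ? ?; apply/andP; split; lra.
  move=> /= /andP[a b].
  have len0 : 0 < (cell x n).2.
    by rewrite lt_neqAle c2 andbT; apply/eqP => e; move: a b; rewrite -e; lra.
  have ab : (cell x n).1 <= u < (cell x n).1 + (cell x n).2.
    rewrite (le_trans _ a) ?lerDl ?mulr_ge0//=; apply: lt_le_trans b _.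
    by rewrite -addrA lerD2l -mulrDr ler_piMr.
  have h1 := IH.2 ab; split=> //.
  case/andP: (ab) => ab1 ab2.
  rewrite h1// IHu//; apply/eqP; rewrite split_unitP//; last first.
    by rewrite divr_ge0 ?subr_ge0//= ltr_pdivrMr// mul1r ltrBlDl.
  rewrite ler_pdivlMr// ltr_pdivrMr// lerBrDr ltrBlDr.
  by apply/andP; split; lra.
move=> /E[h1 h2].
have /andP[a b] := IH.1 h1.
have len0 : 0 < (cell x n).2 by rewrite -(ltrD2l (cell x n).1) addr0 (le_lt_trans a).
move: h2; rewrite /= h1// IHu// => ->.
rewrite invfM mulrA; congr (_ / _).
by field; exact: lt0r_neq0.
Qed.

(** The sample space is all of [R] under the uniform law; the default [x0] outside [[0, 1[] keeps
    the path events explicit there. *)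
Definition chain_state (n : nat) (w : R) : X :=
  if 0 <= w < 1 then (chain n w).1 else x0.

Lemma measurable_chain_path (x : nat -> X) n :
  measurable [set w : measurableTypeR R |
    forall i, (i <= n)%N -> chain_state i w = x i].
Proof.
rewrite (_ : [set _ | _] =
  (`[0, 1[ `&` `[(cell x n).1, (cell x n).1 + (cell x n).2[) `|`
  (~` `[0, 1[ `&` [set _ | forall i, (i <= n)%N -> x0 = x i])).
  apply: measurableU.
    by apply: measurableI; exact: measurable_itv.
  apply: measurableI; first by apply: measurableC; exact: measurable_itv.
  have [h|h] := pselect (forall i, (i <= n)%N -> x0 = x i).
    by rewrite (_ : [set _ | _] = setT)//; apply/seteqP; split.
  by rewrite (_ : [set _ | _] = set0)//; apply/seteqP; split.
apply/seteqP; split=> w /=; rewrite /chain_state !in_itv/=.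
  have [w01 h|_ h] := boolP (0 <= w < 1); last by right.
  by left; split=> //; exact/(chain_cell x n w01).
by case=> [[w01 h]|[/negP/negbTE -> //]]; rewrite w01; exact/(chain_cell x n w01).
Qed.

(** A finite union of path events, over all paths of [n + 1] states that end in [x]. *)
Lemma measurable_chain_state n x :
  measurable [set w : measurableTypeR R | chain_state n w = x].
Proof.
rewrite (_ : [set _ | _] = \big[setU/set0]_(g : {ffun 'I_n.+1 -> X} | g ord_max == x)
   [set w | forall i, (i <= n)%N -> chain_state i w = g (inord i)]).
  by apply: bigsetU_measurable => g _; exact: measurable_chain_path.
apply/seteqP; split=> w /=.
  move=> h; rewrite -bigcup_seq_cond/=.
  exists [ffun i : 'I_n.+1 => chain_state i w] => /=.
    by rewrite mem_index_enum ffunE h eqxx.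
  by move=> i lin; rewrite ffunE inordK.
rewrite -bigcup_seq_cond => -[g /= /andP[_ /eqP gx]] /(_ n (leqnn n)) ->.
by rewrite -gx; congr (g _); apply: val_inj; rewrite /= inordK.
Qed.

Lemma uniform_prob_itv (l e : R) : 0 <= l -> 0 <= e -> l + e <= 1 ->
  uniform_prob (@ltr01 R) `[l, l + e[%classic = e%:E.
Proof.
move=> l0 e0 le1.
rewrite /uniform_prob (eq_integral (fun=> 1%E)); last first.
  move=> x; rewrite inE/= in_itv/= /uniform_pdf => /andP[lx xle].
  by rewrite (le_trans l0 lx) (ltW (lt_le_trans xle le1)) subr0 invr1.
rewrite integral_cst//= mul1e lebesgue_measure_itv/= lte_fin ltrDl.
by case: ltP => [_|e0']; rewrite -?EFinB ?(addrC l) ?addrK// (@le_anti _ _ e 0)// e0 e0'.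
Qed.

Lemma chain_path_prob (x : nat -> X) n :
  uniform_prob (@ltr01 R) [set w | forall i, (i <= n)%N -> chain_state i w = x i]
  = (mu (x 0%N) * \prod_(i < n) K (x i) (x i.+1))%:E.
Proof.
rewrite -cell_len; have [c1 c2 c3] := cell_range x n.
rewrite -(uniform_prob_itv c1 c2 c3).
set E := [set _ | _]; set I := `[_, _[%classic.
pose P : probability (measurableTypeR R) R := uniform_prob (@ltr01 R).
change (P E = P I).
have PI : P `[0, 1[%classic = 1%E.
  by have := @uniform_prob_itv 0 1; rewrite add0r; apply.
have PC : P (~` `[0, 1[%classic) = 0%E.
  by rewrite probability_setC ?[X in (_ - X)%E]PI ?subee//; exact: measurable_itv.
have mE : measurable E by exact: measurable_chain_path.
have mI : measurable (`[0, 1[%classic : set (measurableTypeR R)).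
  exact: measurable_itv.
(* Cells describe path events on [[0, 1[] only; the part of [E] outside that interval has
   probability zero. *)
rewrite -(setUIDK E `[0, 1[) measureU//=; first last.
- by apply/seteqP; split => // w [[_ ?] []].
- exact: measurableD.
- exact: measurableI.
rewrite [X in (_ + X)%E](_ : _ = 0)%E ?adde0; last first.
  apply/eqP; rewrite -measure_le0 -PC; apply: le_measure; rewrite ?inE.
  + exact: measurableD.
  + exact: measurableC.
  + by move=> w [].
congr (P _); apply/seteqP; split=> w /=; rewrite /E/= /I/= !in_itv/= /chain_state.
  by case=> h w01; move: h; rewrite w01 => /(chain_cell x n w01).
move=> h; have w01 : 0 <= w < 1.
  by case/andP: h => a b; rewrite (le_trans c1 a) (lt_le_trans b c3).
by rewrite w01; split=> //; apply/(chain_cell x n w01).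
Qed.

End markov_chain.

(** * Returns of trajectories *)

Section finite_valued.
Context d (Om : measurableType d) (R : realType) (F : finType).
Variable f : Om -> F.
Hypothesis mf : forall y, measurable [set w | f w = y].

(** Freeze a finite-valued random quantity, prove measurability for each value, then glue. States,
    actions, the outcome of a sort and the random index are all treated this way. *)
Lemma measurable_fun_finite_case d' (Y : measurableType d') (h : F -> Om -> Y) :
  (forall y, measurable_fun setT (h y)) ->
  measurable_fun setT (fun w => h (f w) w).
Proof.
move=> mh _ B mB; rewrite setTI.
rewrite (_ : _ @^-1` B =
    \big[setU/set0]_(y : F) ([set w | f w = y] `&` (h y @^-1` B))).
  apply: bigsetU_measurable => y _; apply: measurableI => //.
  by rewrite -[X in measurable X]setTI; exact: mh.
rewrite -bigcup_seq; apply/seteqP; split=> [w Bw|w [y _ [<- //]]].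
by exists (f w) => //; rewrite /= mem_index_enum.
Qed.

Lemma measure_finite_partition (P : {measure set Om -> \bar R}) (E : set Om) :
  measurable E -> P E = (\sum_(y : F) P (E `&` [set w | f w = y]))%E.
Proof.
move=> mE.
have -> : E = \bigcup_(y in [set` index_enum F]) (E `&` [set w | f w = y]).
  apply/seteqP; split=> [w Ew|w [y _ []//]].
  by exists (f w) => //; rewrite /= mem_index_enum.
rewrite measure_fin_bigcup//; last by move=> y _; exact: measurableI.
  rewrite -fsbig_seq ?index_enum_uniq//; apply: eq_bigr => y _; congr (P _).
  apply/seteqP; split=> [w [Ew e]|w [[z _ [Ew _]] e]] //.
  by split=> //; exists y => //=; rewrite mem_index_enum.
by apply/trivIsetP => y z _ _ /eqP yz; apply/seteqP; split=> // w [[_ fy] [_ fz]];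
  exact: yz (etrans (esym fy) fz).
Qed.

Lemma expectation_finite (P : probability Om R) (h : F -> R) :
  ('E_P[fun w => h (f w)] = (\sum_y h y * fine (P [set w | f w = y]))%:E)%E.
Proof.
rewrite unlock.
have E w : (h (f w))%:E = (\sum_y (h y)%:E * (\1_[set w | f w = y] w)%:E)%E.
  rewrite (bigD1 (f w))//= big1 => [|y /eqP yf].
    by rewrite adde0 indicE mem_set// mule1.
  by rewrite indicE memNset ?mule0//= => /esym.
under eq_integral do rewrite E.
have i1 y : P.-integrable setT (fun w => (\1_[set w | f w = y] w)%:E).
  apply: (le_integrable measurableT _ _
    (finite_measure_integrable_cst P 1 measurableT)).
    by apply/measurable_EFinP; exact: measurable_indic.
  by move=> w _ /=; rewrite lee_fin normr1 indicE; case: (_ \in _); rewrite ?normr1 ?normr0.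
rewrite integral_sum//=; last by move=> y; exact: integrableZl.
rewrite -sumEFin; apply: eq_bigr => y _.
rewrite integralZl// integral_indic// setIT EFinM fineK//.
exact: fin_num_measure.
Qed.

End finite_valued.

(** * Laws of the visited state-action pairs *)

Section occupancy.
Variables (R : realType) (X : finType) (K : X -> X -> R).

Definition push_law (m : X -> R) (y : X) : R := \sum_x m x * K x y.

(** Pushing a law forward is adjoint to averaging a function, so the dynamics can be moved from the
    occupancy law onto the reward, where [disc_partial] expects it. *)
Lemma push_law_dual (m f : X -> R) i :
  \sum_x iter i push_law m x * f x = \sum_x m x * iter i (avg_step K) f x.
Proof.
elim: i f => [//|i IH] f; under [RHS]eq_bigr do rewrite iterSr.
rewrite -IH /=.
under eq_bigr do rewrite mulr_suml.
rewrite exchange_big; apply: eq_bigr => x _; rewrite mulr_sumr.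
by apply: eq_bigr => y _; rewrite mulrA.
Qed.

Lemma chain_marginal d (Om : measurableType d) (P : probability Om R)
    (Z : nat -> Om -> X) (m : X -> R) :
  (forall i x, measurable [set w | Z i w = x]) ->
  (forall n (x : nat -> X), P [set w | forall i, (i <= n)%N -> Z i w = x i] =
     (m (x 0%N) * \prod_(i < n) K (x i) (x i.+1))%:E) ->
  forall n k (x : nat -> X),
    P [set w | forall i, (i <= k)%N -> Z (n + i)%N w = x i] =
    (iter n push_law m (x 0%N) * \prod_(i < k) K (x i) (x i.+1))%:E.
Proof.
move=> mZ h; elim=> [|n IH] k x; first exact: h.
have mE j : measurable [set w | forall i, (i <= k)%N -> Z (j + i)%N w = x i].
  rewrite (_ : [set _ | _] =
      \bigcap_(i in [set i | (i <= k)%N]) [set w | Z (j + i)%N w = x i]).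
    by apply: bigcap_measurableType => i _.
  by apply/seteqP; split.
rewrite (measure_finite_partition (mZ n) P (mE _)).
(* The path [x] preceded by [y]: summing over the state [y] at time [n] reduces a window starting at
   [n.+1] to a longer one starting at [n]. *)
pose xs y i := if i is i'.+1 then x i' else y.
rewrite (eq_bigr (fun y => P [set w | forall i, (i <= k.+1)%N -> Z (n + i)%N w = xs y i])).
  under eq_bigr do rewrite IH big_ord_recl /=.
  rewrite sumEFin; congr _%:E; rewrite mulr_suml.
  by apply: eq_bigr => y _; rewrite mulrA.
move=> y _; congr (P _); apply/seteqP; split=> w.
  move=> [h1 h2] [|i]; first by rewrite addn0.
  by rewrite ltnS addnS -addSn; exact: h1.
move=> h1; split; last by have := h1 0%N isT; rewrite /= addn0.
by move=> i ik; have := h1 i.+1 ik; rewrite addnS -addSn.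
Qed.

End occupancy.

Section expected_return.
Variables (R : realType) (S A : finType) (M : mdp R S A).
Variable pi : policy R S A.

Definition sa_step (x y : S * A) : R := ptr M x.1 x.2 y.1 * pi y.1 y.2.

Definition mean_reward (r : reward R S A) (x : S * A) : R :=
  \sum_s ptr M x.1 x.2 s * r (x.1, x.2, s).

Definition qfun (r : reward R S A) : S * A -> R :=
  disc_value sa_step (gamma M) (mean_reward r).

Lemma sa_step_ge0 x y : 0 <= sa_step x y.
Proof. by rewrite mulr_ge0// fdist_ge0. Qed.

Lemma sum_sa_step x (h : S -> R) :
  \sum_y sa_step x y * h y.1 = \sum_s ptr M x.1 x.2 s * h s.
Proof.
rewrite -(pair_bigA _ (fun s a => sa_step x (s, a) * h s))/=.
apply: eq_bigr => s _; rewrite -mulr_suml /sa_step/= -mulr_sumr.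
by rewrite fdist_sum1 mulr1.
Qed.

Lemma sa_step_sum1 x : \sum_y sa_step x y = 1.
Proof.
have := sum_sa_step x (fun=> 1); under eq_bigr do rewrite mulr1.
by move=> ->; under eq_bigr do rewrite mulr1; exact: fdist_sum1.
Qed.

Section trajectory.
Variable mu : S -> A -> R.
Variables (d : _) (Om : measurableType d) (P : probability Om R).
Variables (St : nat -> Om -> S) (Ac : nat -> Om -> A).
Hypothesis hZ : is_trajectory M pi mu P St Ac.

Let Z i w := (St i w, Ac i w).

Let mZ i x : measurable [set w | Z i w = x].
Proof.
case: hZ => mS mA _; case: x => s a.
rewrite (_ : [set _ | _] = [set w | St i w = s] `&` [set w | Ac i w = a]).
  exact: measurableI.
by apply/seteqP; split=> w /=; [case=> -> ->|case=> <- <-].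
Qed.

Let hP n (x : nat -> S * A) : P [set w | forall i, (i <= n)%N -> Z i w = x i] =
  (mu (x 0%N).1 (x 0%N).2 * \prod_(i < n) sa_step (x i) (x i.+1))%:E.
Proof.
case: hZ => _ _ /(_ n (fun i => (x i).1) (fun i => (x i).2)) <-; congr (P _).
apply/seteqP; split=> w h i /h; rewrite /Z; case: (x i) => ? ? /=.
  by case=> -> ->.
by case=> -> ->.
Qed.

Let occ i := iter i (push_law sa_step) (fun x => mu x.1 x.2).

Lemma expectation_reward (r : reward R S A) i :
  ('E_P[fun w => r (St i w, Ac i w, St i.+1 w)] =
    (\sum_x occ i x * mean_reward r x)%:E)%E.
Proof.
have mZZ (xy : (S * A) * (S * A)) : measurable [set w | (Z i w, Z i.+1 w) = xy].
  case: xy => x y.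
  rewrite (_ : [set _ | _] = [set w | Z i w = x] `&` [set w | Z i.+1 w = y]).
    by apply: measurableI.
  by apply/seteqP; split=> w /=; [case=> <- <-|case=> <- <-].
rewrite (expectation_finite mZZ P (fun xy => r (xy.1.1, xy.1.2, xy.2.1))).
pose G (x y : S * A) := r (x.1, x.2, y.1) *
  fine (P [set w | (Z i w, Z i.+1 w) = (x, y)]).
congr _%:E; rewrite (eq_bigr (fun xy => G xy.1 xy.2)); last by case.
rewrite -(pair_bigA _ G)/= {}/G.
apply: eq_bigr => x _.
rewrite /mean_reward -(sum_sa_step x (fun s => r (x.1, x.2, s))) mulr_sumr.
apply: eq_bigr => y _; rewrite mulrC.
(* The reward at time [i] reads the state at time [i + 1], hence the two-point window. *)
pose xs j := if j is 0%N then x else y.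
rewrite (_ : [set _ | _] = [set w | forall j, (j <= 1)%N -> Z (i + j)%N w = xs j]).
  by rewrite (chain_marginal (m := fun x => mu x.1 x.2) mZ hP) big_ord1 /= mulrA.
apply/seteqP; split=> w /=.
  by case=> h1 h2 [|[|//]] _; rewrite ?addn0 ?addn1/=.
by move=> h; have := h 0%N isT; have := h 1%N isT; rewrite addn0 addn1 => -> ->.
Qed.

Lemma measurable_traj_reward (r : reward R S A) i :
  measurable_fun setT (fun w => r (St i w, Ac i w, St i.+1 w) : R).
Proof.
apply: (measurable_fun_finite_case (mZ i)
  (h := fun x w => r (x.1, x.2, St i.+1 w) : R)) => x.
by apply: (measurable_fun_finite_case (mZ i.+1)
  (h := fun y w => r (x.1, x.2, y.1) : R)) => y; exact: measurable_cst.
Qed.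

(** Dominated convergence exchanges the limit of the partial sums with the expectation; each partial
    expectation is then a [disc_partial] by duality. *)
Lemma expectation_discounted_sum (r : reward R S A) :
  (1 - gamma M) * fine 'E_P[discounted_sum M r St Ac] =
  \sum_x mu x.1 x.2 * qfun r x.
Proof.
have g01 := gamma_range M; have /andP[g0 g1] := g01.
pose b := \sum_x `|r x|.
have rb x : `|r x| <= b by rewrite /b (bigD1 x)//= lerDl sumr_ge0.
have b0 : 0 <= b by exact: sumr_ge0.
pose f n w : R := gamma M ^+ n * r (St n w, Ac n w, St n.+1 w).
pose F n w : R := series (f ^~ w) n.
have fb n w : `|f n w| <= b * gamma M ^+ n.
  by rewrite normrM ger0_norm ?exprn_ge0// mulrC ler_wpM2r ?exprn_ge0.
have cg : cvgn (series (fun n => b * gamma M ^+ n)).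
  by apply: is_cvg_geometric_series; rewrite ger0_norm.
have cF w : cvgn (F ^~ w).
  apply: normed_cvg; apply: series_le_cvg cg => n /=; first exact: normr_ge0.
    by rewrite mulr_ge0// exprn_ge0.
  exact: fb.
have mf n : measurable_fun setT (f n).
  by apply: measurable_funM => //; exact: measurable_traj_reward.
have mF n : measurable_fun setT (F n) by exact: measurable_sum.
have mD : measurable_fun setT (discounted_sum M r St Ac).
  apply: (measurable_fun_cvg mF) => w _; exact: cF.
have Fb n w : `|F n w| <= b / (1 - gamma M).
  apply: le_trans (ler_norm_sum _ _ _) _.
  apply: le_trans (ler_sum _ (fun i _ => fb i w)) _.
  rewrite -[leLHS]/(series (geometric b (gamma M)) n).
  rewrite geometric_seriesE ?lt_eqF//= ler_wpM2r ?invr_ge0 ?subr_ge0 ?(ltW g1)//.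
  by rewrite ler_piMr// gerBl exprn_ge0.
(* The discount factor is put inside the reward so that [expectation_reward] applies to the whole
   term. *)
have iE i : (\int[P]_w (f i w)%:E = (gamma M ^+ i *
    \sum_x mu x.1 x.2 * iter i (avg_step sa_step) (mean_reward r) x)%:E)%E.
  have := expectation_reward (fun x => gamma M ^+ i * r x) i.
  rewrite unlock => ->; rewrite -push_law_dual mulr_sumr; congr _%:E.
  apply: eq_bigr => x _; rewrite mulrCA; congr (_ * _); rewrite mulr_sumr.
  by apply: eq_bigr => s _; rewrite mulrCA.
have iF n : (\int[P]_w (F n w)%:E =
    (\sum_x mu x.1 x.2 * disc_partial sa_step (gamma M) (mean_reward r) x n)%:E)%E.
  under eq_integral do rewrite /F /series /= -sumEFin.
  rewrite integral_sum//; last first.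
    move=> i; apply: measurable_bounded_integrable => //.
      by rewrite (le_lt_trans (probability_le1 P measurableT)) ?ltry.
    exists (b * gamma M ^+ i); split=> [|y by0 w _]; first exact: num_real.
    exact: le_trans (fb i w) (ltW by0).
  under eq_bigr do rewrite iE.
  rewrite sumEFin; congr _%:E; under eq_bigr do rewrite mulr_sumr.
  rewrite exchange_big; apply: eq_bigr => x _; rewrite mulr_sumr.
  by apply: eq_bigr => i _; rewrite mulrCA.
have lF : (\int[P]_w (discounted_sum M r St Ac w)%:E =
    (\sum_x mu x.1 x.2 * limn (disc_partial sa_step (gamma M) (mean_reward r) x))%:E)%E.
  have [|||_ _] := @dominated_convergence _ Om R P setT measurableT
    (fun n w => (F n w)%:E) (fun w => (discounted_sum M r St Ac w)%:E)
    (EFin \o cst (b / (1 - gamma M)))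
    (fun n => (measurable_EFinP _ _).2 (mF n)) ((measurable_EFinP _ _).2 mD).
  - by apply/aeW => w _; apply: cvg_EFin; [exact: nearW|exact: cF].
  - exact: finite_measure_integrable_cst.
  - by apply/aeW => w n _ /=; rewrite lee_fin.
  move=> h; apply: (cvg_unique _ h) => //.
  rewrite (_ : [sequence _]_n = fun n => (\sum_x mu x.1 x.2 *
    disc_partial sa_step (gamma M) (mean_reward r) x n)%:E); last first.
    by apply/funext => n /=; rewrite iF.
  apply: cvg_EFin; first exact: nearW.
  apply: cvg_big => [|x _]; first exact: add_continuous.
  apply: cvgMl_tmp; apply: is_cvg_disc_partial => //.
  - exact: sa_step_ge0.
  - exact: sa_step_sum1.
rewrite unlock lF /= mulr_sumr; apply: eq_bigr => x _.
by rewrite /qfun /disc_value mulrCA.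
Qed.

End trajectory.

End expected_return.

Section values.
Variables (R : realType) (S A : finType) (M : mdp R S A).
Implicit Types (pi : policy R S A) (r : reward R S A).

Lemma big_pair (G : S * A -> R) : \sum_x G x = \sum_s \sum_a G (s, a).
Proof. by rewrite pair_bigA; apply: eq_bigr => -[]. Qed.

(** The chain on the unit interval shows that the set given to [xget] is inhabited. Every process
    gives the same formula, so the one picked does not matter. *)
Lemma expected_returnE pi (mu : S -> A -> R) r :
  (forall s a, 0 <= mu s a) -> \sum_x mu x.1 x.2 = 1 ->
  expected_return M pi mu r = \sum_x mu x.1 x.2 * qfun M pi r x.
Proof.
move=> mu0 mu1.
rewrite /expected_return; set V := [set v | _].
have VE v : V v -> v = \sum_x mu x.1 x.2 * qfun M pi r x.
  case=> d [Om [P [St [Ac [hT ->]]]]]; exact: expectation_discounted_sum.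
apply: VE; apply: xgetPex.
(* The chain needs a default state; a [mu] of total mass 1 rules out an empty type. *)
have x0 : S * A.
  case: (pickP (mem [set: S * A]%SET)) => [x _ //|h]; exfalso.
  move: mu1; rewrite big1 => [/eqP|x _]; first by rewrite eq_sym oner_eq0.
  by have := h x; rewrite !inE.
pose K := sa_step M pi; pose m (x : S * A) := mu x.1 x.2.
have m0 x : 0 <= m x by exact: mu0.
have K0 := sa_step_ge0 M pi; have K1 := sa_step_sum1 M pi.
pose Z i w := chain_state m K x0 i w.
exists ((1 - gamma M) * fine ('E_(uniform_prob (@ltr01 R))[discounted_sum M r
  (fun i w => (Z i w).1) (fun i w => (Z i w).2)])%E).
exists _, (measurableTypeR R), (uniform_prob (@ltr01 R)),
  (fun i w => (Z i w).1), (fun i w => (Z i w).2); split=> //.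
have mZ i : forall x, measurable [set w : measurableTypeR R | Z i w = x].
  by move=> x; exact: measurable_chain_state.
have mZQ i (Q : pred (S * A)) : measurable [set w : measurableTypeR R | Q (Z i w)].
  have := @measurable_fun_finite_case _ _ _ _ (mZ i) _ bool (fun x _ => Q x).
  move=> /(_ (fun=> measurable_cst _))/(_ measurableT [set true]).
  by rewrite setTI; apply.
split.
- move=> i s; have := mZQ i (fun x => x.1 == s); congr measurable.
  by apply/seteqP; split=> w /eqP.
- move=> i s; have := mZQ i (fun x => x.2 == s); congr measurable.
  by apply/seteqP; split=> w /eqP.
- move=> n s a.
  have := chain_path_prob m0 mu1 K0 K1 x0 (fun i => (s i, a i)) n.
  rewrite /m /K /sa_step /= => <-; congr (uniform_prob _ _).
  apply/seteqP; split=> w h i /h; rewrite /Z; case: (chain_state _ _ _ _ _) => ? ? /=.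
    by case=> -> ->.
  by case=> -> ->.
Qed.

Lemma qvalE pi r s a : qval M pi r s a = qfun M pi r (s, a).
Proof.
rewrite /qval expected_returnE => [|s' a'|].
- rewrite (bigD1 (s, a))//= eqxx mul1r big1 ?addr0// => -[s' a'] /negbTE /= ->.
  by rewrite mul0r.
- exact: ler0n.
- rewrite (bigD1 (s, a))//= eqxx big1 ?addr0// => -[s' a'] /negbTE /= ->.
  by [].
Qed.

Lemma v0E pi r : v0 M pi r = \sum_s init M s * vval M pi r s.
Proof.
rewrite /v0 expected_returnE => [|s a|].
- rewrite big_pair/=.
  apply: eq_bigr => s _; rewrite mulr_sumr.
  by apply: eq_bigr => a _; rewrite qvalE mulrA.
- by rewrite mulr_ge0// fdist_ge0.
- rewrite big_pair/=.
  under eq_bigr do rewrite -mulr_sumr fdist_sum1 mulr1.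
  exact: fdist_sum1.
Qed.

Lemma qfun_bellman pi r x :
  qfun M pi r x = (1 - gamma M) * mean_reward M r x +
    gamma M * \sum_s ptr M x.1 x.2 s * vval M pi r s.
Proof.
rewrite /qfun (disc_value_bellman (sa_step_ge0 M pi) (sa_step_sum1 M pi)
  (gamma_range M)).
congr (_ + _ * _).
rewrite big_pair/=.
apply: eq_bigr => s _; rewrite mulr_sumr; apply: eq_bigr => a _.
by rewrite qvalE /sa_step/= mulrA.
Qed.

(** Linearity in the exact shape of [kworst_avg], a scaled sum over a list of rewards. *)
Lemma qfun_lin pi (c : R) (rs : seq (reward R S A)) x :
  qfun M pi (fun y => c * \sum_(r <- rs) r y) x =
  c * \sum_(r <- rs) qfun M pi r x.
Proof.
have g01 := gamma_range M.
have K0 := sa_step_ge0 M pi; have K1 := sa_step_sum1 M pi.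
rewrite /qfun -(disc_value_sum K0 K1 g01) -(disc_valueZ K0 K1 g01).
congr disc_value; apply/funext => y; rewrite /mean_reward.
under [in RHS]eq_bigr do rewrite /mean_reward.
rewrite exchange_big/= mulr_sumr; apply: eq_bigr => s _.
by rewrite mulrCA mulr_sumr.
Qed.

Lemma v0_lin pi (c : R) (rs : seq (reward R S A)) :
  v0 M pi (fun y => c * \sum_(r <- rs) r y) = c * \sum_(r <- rs) v0 M pi r.
Proof.
rewrite v0E; under [in RHS]eq_bigr do rewrite v0E.
rewrite exchange_big mulr_sumr /=; apply: eq_bigr => s _.
rewrite -mulr_sumr mulrCA; congr (_ * _); rewrite /vval exchange_big mulr_sumr.
apply: eq_bigr => a _; rewrite qvalE qfun_lin mulrCA; congr (_ * _).
by rewrite mulr_sumr; apply: eq_bigr => r _; rewrite qvalE.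
Qed.

Lemma fdist_norm_le (X : finType) (p : fdist R X) (f : X -> R) (b : R) :
  (forall x, `|f x| <= b) -> `|\sum_x p x * f x| <= b.
Proof.
move=> fb; apply: le_trans (ler_norm_sum _ _ _) _.
rewrite -[leRHS]mul1r -(fdist_sum1 p) mulr_suml; apply: ler_sum => x _.
by rewrite normrM ger0_norm ?fdist_ge0// ler_wpM2l ?fdist_ge0.
Qed.

Lemma v0_bounded (U : R) pi r : reward_bounded U r -> `|v0 M pi r| <= U.
Proof.
move=> rU; rewrite v0E; apply: fdist_norm_le => s.
apply: fdist_norm_le => a; rewrite qvalE; apply: disc_value_norm_le.
- exact: sa_step_ge0.
- exact: sa_step_sum1.
- exact: gamma_range.
- by move=> x; exact: fdist_norm_le.
Qed.

(** Performance difference over one step. The immediate reward occurs in the Bellman equations of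
    both policies and cancels, leaving the advantage against [pi] and the discounted difference at
    the next state. *)
Lemma vval_diff pi' pi r s :
  vval M pi' r s - vval M pi r s =
  \sum_a pi' s a * advantage M pi r s a +
  gamma M * \sum_s' (\sum_a pi' s a * ptr M s a s') *
    (vval M pi' r s' - vval M pi r s').
Proof.
have -> : \sum_a pi' s a * advantage M pi r s a =
    \sum_a pi' s a * qval M pi r s a - vval M pi r s.
  rewrite -[vval M pi r s]mul1r -(fdist_sum1 (pi' s)) mulr_suml -sumrB.
  by apply: eq_bigr => a _; rewrite /advantage mulrBr.
rewrite {1}/vval addrAC; congr (_ - _); rewrite -[LHS](subrK
  (\sum_a pi' s a * qval M pi r s a)) addrC; congr (_ + _).
under [in RHS]eq_bigr do rewrite mulr_suml.
rewrite exchange_big/= mulr_sumr -sumrB; apply: eq_bigr => a _.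
rewrite -mulrBr !qvalE !qfun_bellman/= opprD addrACA subrr add0r -mulrBr.
rewrite mulrCA -sumrB; congr (_ * _); rewrite mulr_sumr.
by apply: eq_bigr => s' _; rewrite -mulrBr mulrA.
Qed.

(** As [pi'] does not change with [t], averaging the per-action bounds under [pi' s] bounds the
    summed advantages by [c]. The accumulated differences [D] then satisfy a Bellman inequality for
    the state chain of [pi']. *)
Lemma regret_le (T : nat) (pi : nat -> policy R S A) (r : nat -> reward R S A)
    (c : R) pi' :
  (forall s a, \sum_(t < T) advantage M (pi t) (r t) s a <= c) ->
  \sum_(t < T) (v0 M pi' (r t) - v0 M (pi t) (r t)) <= c / (1 - gamma M).
Proof.
move=> hc; pose D s := \sum_(t < T) (vval M pi' (r t) s - vval M (pi t) (r t) s).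
pose K s s' := \sum_a pi' s a * ptr M s a s'.
have K0 s s' : 0 <= K s s' by apply: sumr_ge0 => a _; rewrite mulr_ge0 ?fdist_ge0.
have K1 s : \sum_s' K s s' = 1.
  rewrite exchange_big/= -(fdist_sum1 (pi' s)); apply: eq_bigr => a _.
  by rewrite -mulr_sumr fdist_sum1 mulr1.
have DK s : D s <= c + gamma M * \sum_s' K s s' * D s'.
  rewrite {1}/D; under eq_bigr do rewrite vval_diff.
  rewrite big_split/= -mulr_sumr exchange_big/=; apply: lerD; last first.
    rewrite le_eqVlt; apply/orP; left; apply/eqP; congr (_ * _).
    by rewrite exchange_big; apply: eq_bigr => s' _; rewrite -mulr_sumr.
  rewrite -[leRHS]mul1r -(fdist_sum1 (pi' s)) mulr_suml; apply: ler_sum => a _.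
  by rewrite -mulr_sumr ler_wpM2l ?fdist_ge0.
have Dc := discounted_max_le K0 K1 (gamma_range M) DK.
have -> : \sum_(t < T) (v0 M pi' (r t) - v0 M (pi t) (r t)) =
    \sum_s init M s * D s.
  under eq_bigr do rewrite !v0E -sumrB.
  rewrite exchange_big; apply: eq_bigr => s _; rewrite mulr_sumr.
  by apply: eq_bigr => t _; rewrite mulrBr.
move: (c / _) Dc => b Dc.
rewrite -[leRHS]mul1r -(fdist_sum1 (init M)) mulr_suml; apply: ler_sum => s _.
by rewrite ler_wpM2l ?fdist_ge0.
Qed.

End values.

(** * The average of the k worst rewards *)

Section smallest_sum.
Variable R : realType.

(* With [c] the [k]-th smallest entry, the sum of the [k] smallest entries is
   [k * c + \sum_y min (y - c) 0] over the whole list, and the right-hand side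
   is a lower bound for the sum of any [k] entries. *)
Lemma sum_take_sorted_le (s t : seq R) (k : nat) :
  sorted <=%R s -> perm_eq t s -> (k <= size s)%N ->
  \sum_(y <- take k s) y <= \sum_(y <- take k t) y.
Proof.
case: k => [|k] ss ts ks; first by rewrite !take0 !big_nil.
(* After the case split [k.+1] entries are taken, so the largest of them in [s] has index [k]. *)
pose c := nth 0 s k; pose m y := Num.min (y - c) 0.
have kt : (k < size t)%N by rewrite (perm_size ts).
have E u : (k < size u)%N ->
    \sum_(y <- take k.+1 u) (c + m y) = c *+ k.+1 + \sum_(y <- take k.+1 u) m y.
  by move=> ku; rewrite big_split/= big_const_seq count_predT size_take_min
    (minn_idPl ku) iter_addr addr0.
apply: (@le_trans _ _ (c *+ k.+1 + \sum_(y <- s) m y)).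
  rewrite -{2}(cat_take_drop k.+1 s) big_cat/= [X in _ + (_ + X)]big_seq.
  rewrite [X in _ + (_ + X)]big1 ?addr0 => [|y]; last first.
    move=> /(nthP 0)[i]; rewrite size_drop => ik <-; apply: min_idPr.
    rewrite nth_drop subr_ge0 (sorted_leq_nth (@le_trans _ R) (@le_refl _ R))//.
    - by rewrite inE -ltn_subRL.
    - by rewrite addSn ltnW// ltnS leq_addr.
  rewrite -E// big_seq [leRHS]big_seq; apply: ler_sum => y.
  move=> /(nthP 0)[i]; rewrite size_take_min (minn_idPl ks) => ik <-.
  have ic : nth 0 s i - c <= 0.
    rewrite subr_le0 (sorted_leq_nth (@le_trans _ R) (@le_refl _ R))//.
    by rewrite inE (leq_trans ik).
  by rewrite nth_take// /m (min_idPl ic) addrC subrK.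
have <- : \sum_(y <- t) m y = \sum_(y <- s) m y by exact: perm_big.
apply: (@le_trans _ _ (c *+ k.+1 + \sum_(y <- take k.+1 t) m y)).
  rewrite lerD2l -{1}(cat_take_drop k.+1 t) big_cat/= gerDl.
  by apply: sumr_le0 => y _; rewrite ge_min lexx orbT.
rewrite -E//; apply: ler_sum => y _.
by rewrite -lerBrDl ge_min lexx.
Qed.

End smallest_sum.

Section kworst.
Variables (R : realType) (S A : finType) (M : mdp R S A) (k N : nat).
Hypothesis kN : (1 <= k <= N)%N.
Implicit Types (pi : policy R S A) (rs : N.-tuple (reward R S A)).

(** By linearity both sides are averages of [k] values of [v0 M pi'] on one batch: the left takes
    the smallest ones, the right those that the order of [pi] puts first. *)
Lemma v0_kworst_le pi pi' rs :
  v0 M pi' (kworst_avg M k pi' rs) <= v0 M pi' (kworst_avg M k pi rs).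
Proof.
case/andP: kN => k1 kN'.
rewrite /kworst_avg !v0_lin ler_wpM2l ?invr_ge0//.
set leT := (X in sort X _); set leT' := (X in _ <= \sum_(_ <- take k (sort X _)) _).
rewrite -(big_map (v0 M pi') xpredT id) -[leRHS](big_map (v0 M pi') xpredT id).
rewrite !map_take; apply: sum_take_sorted_le.
- rewrite (_ : map _ _ = sort <=%R (map (v0 M pi') rs)); last by rewrite sort_map.
  exact: (sort_sorted (@le_total _ R)).
- apply: perm_map; rewrite perm_sort perm_sym perm_sort; exact: perm_refl.
- by rewrite size_map size_sort size_tuple.
Qed.

Lemma kworst_bounded (U : R) pi rs :
  (forall j, reward_bounded U (tnth rs j)) ->
  reward_bounded U (kworst_avg M k pi rs).
Proof.
case/andP: kN => k1 kN' rsU x; rewrite /kworst_avg.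
rewrite normrM ger0_norm ?invr_ge0// ler_pdivrMl ?ltr0n//.
apply: le_trans (ler_norm_sum _ _ _) _.
set u := take _ _.
have su : size u = k by rewrite size_take_min size_sort size_tuple (minn_idPl kN').
rewrite -[X in X%:R]su mulr_natl -[leRHS]addr0 -iter_addr -(@count_predT _ u).
rewrite -big_const_seq big_seq [leRHS]big_seq; apply: ler_sum => r.
by move=> /mem_take; rewrite mem_sort => /tnthP[j ->]; exact: rsU.
Qed.

(** The selection is made to depend only on a finite boolean table of comparisons between indices.
    For a fixed table the average is a fixed combination of the draws, hence measurable. *)
Lemma kworst_index pi rs x :
  kworst_avg M k pi rs x = k%:R^-1 *
    \sum_(j <- take k (sort (fun i j => [ffun ij : 'I_N * 'I_N =>
         v0 M pi (tnth rs ij.1) <= v0 M pi (tnth rs ij.2)] (i, j)) (enum 'I_N)))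
      tnth rs j x.
Proof.
rewrite /kworst_avg -{1}(map_tnth_enum rs) sort_map -map_take big_map.
congr (_ * _); apply: congr_big => //; congr (take k _).
by congr (sort _ _); apply/funext => i; apply/funext => j; rewrite /relpre/= ffunE.
Qed.

End kworst.

(** * Measurability of the policies *)

Section measurability.
Context d (Om : measurableType d) (R : realType).

Lemma measurable_fun_spaceP (I : finType) (f : Om -> fun_space R I) :
  measurable_fun setT f <-> forall i, measurable_fun setT (fun w => f w i : R).
Proof.
split=> [mf i|mf].
  apply: (measurableT_comp (f := fun g : fun_space R I => g i : R)) mf.
  move=> _ B mB; rewrite setTI; apply: sub_sigma_algebra.
  by exists i, B.
apply: (@measurability _ _ Om (fun_space R I) setT f (@cylinders R I)) => //.
move=> _ [_ [i [B [mB ->]]] <-].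
exact: (mf i measurableT B mB).
Qed.

Variables (S A : finType) (M : mdp R S A).
Variable pi : Om -> policy R S A.
Hypothesis mpi : forall s a, measurable_fun setT (fun w => pi w s a : R).

Lemma measurable_qfun (r : Om -> reward R S A) x :
  measurable_fun setT r ->
  measurable_fun setT (fun w => qfun M (pi w) (r w) x : R).
Proof.
move=> /measurable_fun_spaceP mr.
have mmr y : measurable_fun setT (fun w => mean_reward M (r w) y : R).
  by apply: measurable_sum => s; apply: measurable_funM => //; exact: mr.
apply: measurable_funM => //.
apply: (@measurable_fun_cvg _ Om R setT
  (fun n w => disc_partial (sa_step M (pi w)) (gamma M) (mean_reward M (r w)) x n)).
  move=> n; elim: n x => [|n IH] x.
    rewrite (_ : (fun w => _) = cst 0) => [|]; first exact: measurable_cst.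
    by apply/funext => w; rewrite /disc_partial /series/= big_geq.
  under eq_fun do rewrite disc_partialS.
  apply: measurable_funD => //; apply: measurable_funM => //.
  apply: measurable_sum => y; apply: measurable_funM => //.
  exact: measurable_funM.
move=> w _; apply: is_cvg_disc_partial; last exact: gamma_range.
- exact: sa_step_ge0.
- exact: sa_step_sum1.
Qed.

Lemma measurable_v0 (r : Om -> reward R S A) :
  measurable_fun setT r -> measurable_fun setT (fun w => v0 M (pi w) (r w) : R).
Proof.
move=> mr; under eq_fun do rewrite v0E.
apply: measurable_sum => s; apply: measurable_funM => //.
apply: measurable_sum => a; apply: measurable_funM => //.
by under eq_fun do rewrite qvalE; exact: measurable_qfun.
Qed.

Lemma measurable_kworst k N (X : Om -> N.-tuple (reward R S A)) :
  measurable_fun setT X ->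
  measurable_fun setT (fun w => kworst_avg M k (pi w) (X w)).
Proof.
move=> /measurable_fun_tnthP mX.
have mXj j : measurable_fun setT (fun w => tnth (X w) j) by exact: (mX j).
pose f w := [ffun ij : 'I_N * 'I_N =>
  v0 M (pi w) (tnth (X w) ij.1) <= v0 M (pi w) (tnth (X w) ij.2)].
have mf b : measurable [set w | f w = b].
  rewrite (_ : [set _ | _] =
      \big[setI/setT]_(ij : 'I_N * 'I_N) [set w | f w ij = b ij]).
    apply: bigsetI_measurable => ij _.
    have := measurable_fun_ler (measurable_v0 (mXj ij.1)) (measurable_v0 (mXj ij.2)).
    move=> /(_ measurableT [set b ij] I); rewrite setTI; congr measurable.
    by apply/seteqP; split=> w; rewrite /f /= ffunE.
  rewrite -bigcap_seq; apply/seteqP; split=> [w <- //|w h].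
  by apply/ffunP => ij; apply: h; rewrite /= mem_index_enum.
apply/measurable_fun_spaceP => x; under eq_fun do rewrite kworst_index.
apply: (measurable_fun_finite_case mf (h := fun b w => k%:R^-1 *
  \sum_(j <- take k (sort (fun i j => b (i, j)) (enum 'I_N))) tnth (X w) j x)).
move=> b; apply: measurable_funM => //; apply: measurable_sum => j.
by have /measurable_fun_spaceP := mXj j; exact.
Qed.

End measurability.

Section policy_measurability.
Context d (Om : measurableType d) (R : realType).
Variables (S A : finType) (M : mdp R S A) (k N : nat) (L : learners R S A).
Hypothesis mL : measurable_learners L.
Variable X : nat -> Om -> N.-tuple (reward R S A).
Hypothesis mX : forall t, measurable_fun setT (X t).

Lemma measurable_kN_cfr t s a :
  measurable_fun setT (fun w => kN_cfr M k L (X ^~ w) t s a : R).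
Proof.
pose e w t' (pi : policy R S A) := kworst_avg M k pi (X t' w).
(* Measurability of learners is stated on tuples while histories are plain sequences, so the
   induction builds a tuple-valued version of the history. *)
suff H : forall t s, exists h : Om -> t.-tuple (fun_space R A),
    measurable_fun setT h /\ forall w, h w = cfr_history M L (e w) t s :> seq _.
  have [h [mh hE]] := H t s.
  have := measurableT_comp (@mL s a t) mh; congr measurable_fun.
  by apply/funext => w; rewrite /= hE.
move=> {}t; elim: t => [|t IH] {}s.
  by exists (fun=> [tuple]); split => //; exact: measurable_cst.
have mpi s' a' : measurable_fun setT
    (fun w => L s' (cfr_history M L (e w) t s') a' : R).
  have [h [mh hE]] := IH s'.
  have := measurableT_comp (@mL s' a' t) mh; congr measurable_fun.
  by apply/funext => w; rewrite /= hE.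
have [h [mh hE]] := IH s.
pose pit w : policy R S A := fun s' => L s' (cfr_history M L (e w) t s').
exists (fun w => [tuple of rcons (h w) (qval M (pit w) (e w t (pit w)) s)]).
split=> [|w]; last by rewrite /= hE.
have mq : measurable_fun setT (fun w => qval M (pit w) (e w t (pit w)) s).
  apply/measurable_fun_spaceP => a'; under eq_fun do rewrite qvalE.
  by apply: measurable_qfun => //; exact: measurable_kworst.
apply/measurable_fun_tnthP => i.
have [it|ti] := ltnP i t.
  have := (measurable_fun_tnthP h).1 mh (Ordinal it); congr measurable_fun.
  apply/funext => w /=; rewrite !(tnth_nth (fun=> 0)) /= nth_rcons size_tuple.
  by rewrite it.
move: mq; congr measurable_fun.
apply/funext => w /=; rewrite (tnth_nth (fun=> 0)) /= nth_rcons size_tuple.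
have -> : i = t :> nat by apply/eqP; rewrite eqn_leq ti -ltnS ltn_ord.
by rewrite ltnn eqxx.
Qed.

End policy_measurability.

(** * Laws of i.i.d. samples *)

Section iid_laws.
Context d (X : measurableType d) (R : realType).

Lemma measurable_rectangle n (B : 'I_n -> set X) :
  (forall j, measurable (B j)) ->
  measurable [set x : n.-tuple X | forall j, B j (tnth x j)].
Proof.
move=> mB; rewrite (_ : [set _ | _] =
    \big[setI/setT]_j [set x : n.-tuple X | B j (tnth x j)]).
  apply: bigsetI_measurable => j _.
  rewrite -[X in measurable X]setTI.
  exact: (measurable_tnth j measurableT (mB j)).
rewrite -bigcap_seq; apply/seteqP; split=> x h j; first by move=> _; exact: h.
by apply: h; rewrite /= mem_index_enum.
Qed.

Lemma iid_law_rectangle (Q : probability X R) n (B : 'I_n -> set X) :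
  (forall j, measurable (B j)) ->
  iid_law Q n [set x | forall j, B j (tnth x j)] = (\prod_j Q (B j))%E.
Proof.
elim: n B => [|n IH] B mB.
  rewrite big_ord0 /= diracE mem_set// => -[].
  by [].
rewrite big_ord_recl -(IH (fun j => B (lift ord0 j)))// -product_measure1E//; last first.
  exact: (measurable_rectangle (B := fun j => B (lift ord0 j))).
rewrite /= /distribution /pushforward; congr product_measure1.
apply/seteqP; split=> [[x xs]|[x xs] [/= h0 hs]] /=.
  move=> h; split=> [|j] /=; first by have := h ord0; rewrite /tuple_cons tnth0.
  by have := h (lift ord0 j); rewrite /tuple_cons tnthS.
move=> j; case: (unliftP ord0 j) => [j' ->|->]; rewrite /tuple_cons.
  by rewrite tnthS; exact: hs.
by rewrite tnth0.
Qed.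

Lemma iid_law_all1 (Q : probability X R) n (B : set X) :
  measurable B -> Q B = 1%E -> iid_law Q n [set x | forall j, B (tnth x j)] = 1%E.
Proof.
move=> mB QB; rewrite (iid_law_rectangle Q (B := fun=> B))//.
by rewrite big1.
Qed.

End iid_laws.

Section iid_law_unique.
Context d (X : measurableType d) (R : realType).

(** Rectangles in the individual draws form a generating family closed under intersection. The
    factor [c] lets the lemma cover a measure restricted to an event such as [tau = i]. *)
Lemma iid_law2_unique (Q : probability X R) (T N : nat) (c : R)
    (m : {measure set (T.-tuple (N.-tuple X)) -> \bar R}) :
  0 <= c ->
  (forall B : 'I_T -> 'I_N -> set X, (forall t j, measurable (B t j)) ->
    m [set x | forall t j, B t j (tnth (tnth x t) j)] =
      (c%:E * \prod_t \prod_j Q (B t j))%E) ->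
  forall E, measurable E -> m E = (c%:E * iid_law (iid_law Q N) T E)%E.
Proof.
move=> c0 hm.
pose rect (B : 'I_T -> 'I_N -> set X) : set (T.-tuple (N.-tuple X)) :=
  [set x | forall t j, B t j (tnth (tnth x t) j)].
pose G := [set E | exists B, (forall t j, measurable (B t j)) /\ E = rect B].
have mrect B : (forall t j, measurable (B t j)) -> measurable (rect B).
  move=> mB; apply: (measurable_rectangle
    (B := fun t => [set x : N.-tuple X | forall j, B t j (tnth x j)])).
  by move=> t; exact: measurable_rectangle.
have GE : (@measurable _ (T.-tuple (N.-tuple X))) = <<s G >>.
  apply/seteqP; split; last first.
    apply: smallest_sub; first exact: sigma_algebra_measurable.
    by move=> _ [B [mB ->]]; exact: mrect.
  move=> E mE.
  pose Y := g_sigma_algebraType G.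
  (* Measurability of the identity out of the sigma-algebra generated by [G], tested on single
     coordinates, is the inclusion sought. *)
  have mid : measurable_fun [set: Y] (id : Y -> T.-tuple (N.-tuple X)).
    apply/measurable_fun_tnthP => t; apply/measurable_fun_tnthP => j _ B mB.
    rewrite setTI; apply: sub_sigma_algebra.
    exists (fun t' j' => if (t' == t) && (j' == j) then B else setT); split.
      by move=> t' j'; case: ifP.
    apply/seteqP; split=> x /=; last by move=> /(_ t j); rewrite !eqxx.
    by move=> Bx t' j'; case: ifP => // /andP[/eqP -> /eqP ->].
  by have := mid measurableT E mE; rewrite setTI.
have GI : setI_closed G.
  move=> _ _ [B1 [mB1 ->]] [B2 [mB2 ->]].
  exists (fun t j => B1 t j `&` B2 t j); split.
    by move=> t j; exact: measurableI.
  apply/seteqP; split=> x /=; first by case=> h1 h2 t j; split; [exact: h1|exact: h2].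
  by move=> h; split=> t j; case: (h t j).
have rectE B : (forall t j, measurable (B t j)) ->
    iid_law (iid_law Q N) T (rect B) = (\prod_t \prod_j Q (B t j))%E.
  move=> mB; have := iid_law_rectangle (iid_law Q N)
    (B := fun t => [set x : N.-tuple X | forall j, B t j (tnth x j)]).
  move=> ->; last by move=> t; exact: measurable_rectangle.
  by apply: eq_bigr => t _; rewrite iid_law_rectangle.
move=> E mE.
have := @measure_unique _ R _ G (fun=> setT) GE GI _ _ m
  (mscale (NngNum c0) (iid_law (iid_law Q N) T)) _ _ E mE; apply.
- by move=> _; exists (fun _ _ => setT); split=> //; apply/seteqP; split.
- by rewrite bigcup_const.
- by move=> _ [B [mB ->]]; rewrite hm// -rectE.
- move=> _; have := hm (fun _ _ => setT) (fun _ _ => measurableT).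
  rewrite (_ : [set _ | _] = setT); last by apply/seteqP; split.
  move=> ->; rewrite big1 ?mule1 ?ltry// => t _.
  by rewrite big1// => j _; exact: probability_setT.
Qed.

End iid_law_unique.

(** * Hoeffding's lemma *)

Section almost_sure.
Context d (X : measurableType d) (R : realType) (P : probability X R).
Variable G : set X.
Hypothesis mG : measurable G.
Hypothesis PG : P G = 1%E.

(** The reward bound holds almost surely only; this and the next lemmas give integral estimates
    whose pointwise hypotheses are required just on a set [G] of full measure. *)
Lemma as_eq_integral (f g : X -> \bar R) :
  measurable_fun setT f -> measurable_fun setT g ->
  (forall x, G x -> f x = g x) -> (\int[P]_x f x = \int[P]_x g x)%E.
Proof.
move=> mf mg fg; have PN : P (~` G) = 0%E by rewrite probability_setC// PG subee.
apply: ae_eq_integral => //; exists (~` G); split; [exact: measurableC|exact: PN|].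
by move=> x /= h Gx; apply: h => _; exact: fg.
Qed.

Lemma measurable_patch (f : X -> R) :
  measurable_fun setT f -> measurable_fun setT (f \_ G).
Proof.
by move=> mf; apply: (measurable_restrictT f mG).1; exact: measurable_funTS mf.
Qed.

Lemma as_restrict_EFin (f : X -> R) : measurable_fun setT f ->
  (\int[P]_x (f x)%:E = \int[P]_x ((f \_ G) x)%:E)%E.
Proof.
move=> mf; apply: as_eq_integral.
- exact/measurable_EFinP.
- by apply/measurable_EFinP; exact: measurable_patch.
- by move=> x Gx; rewrite patchE mem_set.
Qed.

Lemma as_bounded_integrable (f : X -> R) (b : R) : measurable_fun setT f ->
  (forall x, G x -> `|f x| <= b) -> P.-integrable setT (EFin \o f).
Proof.
move=> mf fb; apply/integrableP; split; first exact/measurable_EFinP.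
rewrite (@as_eq_integral _ (fun x => ((fun y => `|f y|) \_ G x)%:E)).
- apply: (@le_lt_trans _ _ (\int[P]_x (`|b|)%:E)%E).
    apply: ge0_le_integral => //.
    + by move=> x _; rewrite lee_fin patchE; case: ifP => //=.
    + by apply/measurable_EFinP/measurable_patch; exact: measurableT_comp.
    + move=> x _; rewrite lee_fin patchE; case: ifPn => [|_]; last exact: normr_ge0.
      by rewrite inE => /fb h; rewrite (le_trans h)// ler_norm.
  by rewrite integral_cst// [X in (_ * X)%E]probability_setT mule1 ltry.
- by apply: measurableT_comp => //; exact/measurable_EFinP.
- by apply/measurable_EFinP/measurable_patch; exact: measurableT_comp.
- by move=> x Gx; rewrite patchE mem_set.
Qed.

Lemma as_le_Rintegral (f g : X -> R) :
  P.-integrable setT (EFin \o f) -> P.-integrable setT (EFin \o g) ->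
  (forall x, G x -> f x <= g x) -> \int[P]_x f x <= \int[P]_x g x.
Proof.
move=> fi gi fg.
have mf : measurable_fun setT f by apply/measurable_EFinP; exact: measurable_int fi.
have mg : measurable_fun setT g by apply/measurable_EFinP; exact: measurable_int gi.
have ir h : measurable_fun setT h -> P.-integrable setT (EFin \o h) ->
    P.-integrable setT (EFin \o (h \_ G)).
  move=> mh hi; apply: (le_integrable measurableT _ _ hi).
    by apply/measurable_EFinP; exact: measurable_patch.
  by move=> x _ /=; rewrite patchE; case: ifP => // _; rewrite normr0 lee_fin.
rewrite /Rintegral (as_restrict_EFin mf) (as_restrict_EFin mg).
apply: le_Rintegral => //; [exact: ir|exact: ir|].
by move=> x _; rewrite !patchE; case: ifPn => //; rewrite inE => /fg.
Qed.

Lemma as_Rintegral_norm_le (f : X -> R) (b : R) : measurable_fun setT f ->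
  (forall x, G x -> `|f x| <= b) -> `|\int[P]_x f x| <= b.
Proof.
move=> mf fb.
have fi := as_bounded_integrable mf fb.
have ci c : P.-integrable setT (EFin \o cst c) by exact: finite_measure_integrable_cst.
have cE c : \int[P]_x (cst c x) = c by rewrite Rintegral_cst// [X in fine X]probability_setT mulr1.
rewrite ler_norml; apply/andP; split; [rewrite -[leLHS]cE|rewrite -[leRHS]cE];
  by apply: as_le_Rintegral => // x /fb; rewrite ler_norml => /andP[].
Qed.

End almost_sure.

Section hoeffding.
Variable R : realType.

(** Convexity by tangents: the tangent of [expR] at [z = th * y] lies below it at the end points
    [th * c] and [- (th * c)]. The weights [t] and [s] average these points to [z], so the linear
    terms cancel. *)
Lemma expR_chord (c y th : R) : 0 < c -> `|y| <= c ->
  expR (th * y) <= (1 + y / c) / 2 * expR (th * c) + (1 - y / c) / 2 * expR (- (th * c)).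
Proof.
move=> c0; rewrite ler_norml => /andP[cy yc].
set z := th * y; set t := (1 + y / c) / 2; set s := (1 - y / c) / 2.
have yc1 : y / c <= 1 by rewrite ler_pdivrMr ?mul1r.
have yc2 : - 1 <= y / c by rewrite ler_pdivlMr// mulN1r.
have t0 : 0 <= t by rewrite /t; lra.
have s0 : 0 <= s by rewrite /s; lra.
have E x : expR z * (1 + (x - z)) <= expR x.
  by rewrite -[in leRHS](subrKC z x) expRD ler_wpM2l ?expR_ge0// expR_ge1Dx.
apply: le_trans (lerD (ler_wpM2l t0 (E _)) (ler_wpM2l s0 (E _))).
rewrite le_eqVlt; apply/orP; left; apply/eqP.
have : t * (1 + (th * c - z)) + s * (1 + (- (th * c) - z)) = 1.
  by rewrite /t /s /z; field; exact: lt0r_neq0.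
move=> h; rewrite -[LHS]mulr1 -[X in _ * X = _]h; ring.
Qed.

Lemma expn2_fact_le k : (2 ^ k * k`! <= k.*2`!)%N.
Proof.
elim: k => // k IH; rewrite doubleS !factS expnS mulnACA; apply: leq_mul.
  by rewrite mul2n doubleS.
by apply: leq_trans IH _; exact: leq_pmull.
Qed.

Lemma cosh_le (x : R) : (expR x + expR (- x)) / 2 <= expR (x ^+ 2 / 2).
Proof.
(* Partial sums of even length, so that the odd powers of [x] and [- x] cancel in full; the even
   ones are then compared termwise through [expn2_fact_le]. *)
pose u n := (series (exp_coeff x) n.*2 + series (exp_coeff (- x)) n.*2) / 2.
have dbl : n.*2 @[n --> \oo] --> \oo.
  apply/cvgnyPge => n; near=> m; rewrite -addnn (leq_trans _ (leq_addr m m))//.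
  by near: m; exact: nbhs_infty_ge.
have uE : u @ \oo --> (expR x + expR (- x)) / 2.
  apply: cvgMr_tmp; apply: cvgD; apply: (cvg_comp _ _ dbl);
    exact: is_cvg_series_exp_coeff.
rewrite -(cvg_lim _ uE)//; apply: limr_le; first by apply/cvg_ex; eexists; exact: uE.
apply: nearW => n.
have -> : u n = \sum_(0 <= k < n) x ^+ k.*2 / (k.*2)`!%:R.
  rewrite /u; elim: n => [|n IH]; first by rewrite /series/= !big_geq// addr0 mul0r.
  rewrite doubleS !seriesSr big_nat_recr//= -IH /exp_coeff/=.
  have xN : (- x) ^+ n.*2 = x ^+ n.*2.
    by rewrite exprNn -signr_odd odd_double expr0 mul1r.
  rewrite !exprS xN.
  have h1 : n.*2`!%:R != 0 :> R by rewrite pnatr_eq0 -lt0n fact_gt0.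
  have h2 : (n.*2.+1)`!%:R != 0 :> R by rewrite pnatr_eq0 -lt0n fact_gt0.
  by move: (n.*2`!%:R) ((n.*2.+1)`!%:R) h1 h2 => a b h1 h2; field; rewrite h1 h2.
apply: (@le_trans _ _ (series (exp_coeff (x ^+ 2 / 2)) n)).
  rewrite /series/=; apply: ler_sum => k _; rewrite /exp_coeff/=.
  have E : 2 ^+ k * k`!%:R = (2 ^ k * k`!)%N%:R :> R by rewrite natrM natrX.
  rewrite expr_div_n -exprM mul2n -mulrA -invfM E ler_wpM2l//.
    by rewrite -mul2n exprM exprn_ge0// sqr_ge0.
  rewrite lef_pV2 ?posrE ?ltr0n ?muln_gt0 ?expn_gt0 ?fact_gt0//.
  by rewrite ler_nat expn2_fact_le.
apply: nondecreasing_cvgn_le; last exact: is_cvg_series_exp_coeff.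
apply/nondecreasing_seqP => m; rewrite seriesSr lerDl.
by apply: exp_coeff_ge0; rewrite divr_ge0// sqr_ge0.
Unshelve. all: by end_near. Qed.

Lemma hoeffding_mgf d (X : measurableType d) (P : probability X R) (G : set X)
    (Y : X -> R) (c th : R) :
  measurable G -> P G = 1%E -> measurable_fun setT Y ->
  (forall x, G x -> `|Y x| <= c) -> \int[P]_x Y x <= 0 -> 0 <= th ->
  (\int[P]_x (expR (th * Y x))%:E <= (expR (th ^+ 2 * c ^+ 2 / 2))%:E)%E.
Proof.
move=> mG PG mY Yc EY th0.
have Yi := as_bounded_integrable mG PG mY Yc.
have meY : measurable_fun setT (fun x => expR (th * Y x)).
  by apply: measurableT_comp => //; exact: measurable_funM.
have eYi : P.-integrable setT (EFin \o (fun x => expR (th * Y x))).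
  apply: (as_bounded_integrable mG PG meY (b := expR (th * c))) => x Gx.
  rewrite ger0_norm ?expR_ge0// ler_expR ler_wpM2l// (le_trans (ler_norm _))//.
  exact: Yc.
rewrite -[leLHS]fineK; last exact: integrable_fin_num eYi.
rewrite lee_fin -/(Rintegral P setT (fun x => expR (th * Y x))).
have ci b : P.-integrable setT (EFin \o cst b) by exact: finite_measure_integrable_cst.
have cE b : \int[P]_x (cst b x) = b by rewrite Rintegral_cst// [X in fine X]probability_setT mulr1.
(* The chord divides by [c]; if [c <= 0], then [Y] vanishes on [G]. *)
have [c0|c0] := ltP 0 c; last first.
  apply: (@le_trans _ _ 1); last by rewrite -expR0 ler_expR divr_ge0// mulr_ge0// sqr_ge0.
  rewrite -[leRHS]cE; apply: (as_le_Rintegral mG PG) => // x /Yc h.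
  have /eqP -> : Y x == 0 by rewrite -normr_le0 (le_trans h).
  by rewrite mulr0 expR0.
set ep := expR (th * c); set em := expR (- (th * c)).
have emp : em <= ep by rewrite ler_expR ge0_cp// mulr_ge0// ltW.
apply: (@le_trans _ _ ((ep + em) / 2)); last first.
  by apply: le_trans (cosh_le _) _; rewrite exprMn.
have bYi b : P.-integrable setT (EFin \o (fun x => b * Y x)).
  exact: (integrableZl measurableT b Yi).
apply: (@le_trans _ _ (\int[P]_x ((ep + em) / 2 + (ep - em) / 2 / c * Y x))).
  apply: (as_le_Rintegral mG PG) => //.
    exact: (integrableD measurableT (ci _) (bYi _)).
  move=> x /Yc h; apply: le_trans (expR_chord th c0 h) _.
  rewrite -/ep -/em le_eqVlt; apply/orP; left; apply/eqP; field.
  exact: lt0r_neq0.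
rewrite (RintegralD measurableT (ci _) (bYi _)).
rewrite RintegralZl// [X in X + _]cE gerDl mulr_ge0_le0//.
by rewrite divr_ge0 ?(ltW c0)// divr_ge0// subr_ge0.
Qed.

End hoeffding.

(** * The objective of the robust policy *)

Section robust_value.
Variables (R : realType) (S A : finType) (M : mdp R S A) (U : R).
Variable Rw : probability (reward R S A) R.
Hypothesis hRw : Rw (reward_bounded U) = 1%E.
Variables (k N : nat).
Hypothesis kN : (1 <= k <= N)%N.

Let Q := iid_law Rw N.

Definition bounded_batch : set (N.-tuple (reward R S A)) :=
  [set rs | forall j, reward_bounded U (tnth rs j)].

Lemma measurable_reward_bounded : measurable (@reward_bounded R S A U).
Proof.
rewrite (_ : reward_bounded U =
    \big[setI/setT]_(x : S * A * S) [set r : reward R S A | `|r x| <= U]).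
  apply: bigsetI_measurable => x _.
  have mx : measurable_fun [set: reward R S A] (fun r => r x : R).
    by have /measurable_fun_spaceP := @measurable_id _ (reward R S A) setT; apply.
  have mn : measurable_fun [set: reward R S A] (fun r => `|r x| : R).
    exact: measurableT_comp mx.
  have := measurable_fun_ler mn (@measurable_cst _ _ _ _ setT U).
  by move=> /(_ measurableT [set true] I); rewrite setTI.
rewrite -bigcap_seq; apply/seteqP; split=> r h x; first by move=> _; exact: h.
by apply: h; rewrite /= mem_index_enum.
Qed.

Lemma measurable_bounded_batch : measurable bounded_batch.
Proof.
exact: (measurable_rectangle (fun=> measurable_reward_bounded)).
Qed.

Lemma bounded_batch_prob : Q bounded_batch = 1%E.
Proof. exact: iid_law_all1 measurable_reward_bounded hRw. Qed.

Lemma v0_kworst_bounded pi pi' rs : bounded_batch rs ->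
  `|v0 M pi (kworst_avg M k pi' rs)| <= U.
Proof. by move=> h; apply: v0_bounded; exact: kworst_bounded. Qed.

Lemma measurable_v0_kworst pi pi' :
  measurable_fun setT (fun rs : N.-tuple _ => v0 M pi (kworst_avg M k pi' rs) : R).
Proof.
apply: (measurable_v0 M (pi := fun=> pi)) => [s a|]; first exact: measurable_cst.
apply: (measurable_kworst M (pi := fun=> pi')) => [s a|]; first exact: measurable_cst.
exact: measurable_id.
Qed.

Lemma integrable_v0_kworst pi pi' :
  Q.-integrable setT (EFin \o (fun rs => v0 M pi (kworst_avg M k pi' rs))).
Proof.
apply: (as_bounded_integrable measurable_bounded_batch bounded_batch_prob
  (measurable_v0_kworst pi pi')) => rs; exact: v0_kworst_bounded.
Qed.

Lemma JvalE pi : Jval M Rw k N pi = \int[Q]_rs v0 M pi (kworst_avg M k pi rs).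
Proof.
have mk : measurable_fun [set: N.-tuple (reward R S A)] (kworst_avg M k pi).
  apply: (measurable_kworst M (pi := fun=> pi)) => [s a|]; first exact: measurable_cst.
  exact: measurable_id.
rewrite /Jval /mu_kN /Rintegral; congr fine.
rewrite integral_pushforward//.
- apply/measurable_EFinP/(measurable_v0 M (pi := fun=> pi)) => [s a|].
    exact: measurable_cst.
  exact: measurable_id.
- exact: integrable_v0_kworst.
Qed.

Lemma Jval_bounded pi : `|Jval M Rw k N pi| <= U.
Proof.
rewrite JvalE; apply: (as_Rintegral_norm_le measurable_bounded_batch
  bounded_batch_prob (measurable_v0_kworst pi pi)) => rs.
exact: v0_kworst_bounded.
Qed.

Lemma Jval_le pi pi' :
  Jval M Rw k N pi' <= \int[Q]_rs v0 M pi' (kworst_avg M k pi rs).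
Proof.
rewrite JvalE.
apply: (le_Rintegral measurableT (integrable_v0_kworst pi' pi')
  (integrable_v0_kworst pi' pi)) => rs _.
exact: v0_kworst_le.
Qed.

Definition gap_noise pi pi' (rs : N.-tuple (reward R S A)) : R :=
  Jval M Rw k N pi' - Jval M Rw k N pi -
  (v0 M pi' (kworst_avg M k pi rs) - v0 M pi (kworst_avg M k pi rs)).

Lemma gap_noise_mgf pi pi' (th : R) : 0 <= th ->
  (\int[Q]_rs (expR (th * gap_noise pi pi' rs))%:E <=
    (expR (th ^+ 2 * (4 * U) ^+ 2 / 2))%:E)%E.
Proof.
move=> th0; apply: (hoeffding_mgf measurable_bounded_batch bounded_batch_prob) => //.
- apply: measurable_funB; first exact: measurable_cst.
  by apply: measurable_funB; exact: measurable_v0_kworst.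
- move=> rs h; rewrite /gap_noise.
  apply: le_trans (ler_normB _ _) _.
  (* Two values of [J] and two sampled returns, each at most [U] in absolute value. *)
  rewrite (_ : 4 * U = U + U + (U + U)); last by ring.
  by apply: lerD; apply: le_trans (ler_normB _ _) _; apply: lerD;
    [exact: Jval_bounded|exact: Jval_bounded|exact: v0_kworst_bounded..].
- rewrite /gap_noise RintegralB//; last first.
  + exact: (integrableB measurableT (integrable_v0_kworst _ _) (integrable_v0_kworst _ _)).
  + exact: finite_measure_integrable_cst.
  rewrite (RintegralB measurableT (integrable_v0_kworst _ _) (integrable_v0_kworst _ _)).
  rewrite Rintegral_cst// [X in fine X]probability_setT mulr1 -(JvalE pi).
  by rewrite opprB addrA subrK subr_le0; exact: Jval_le.
Qed.

Lemma measurable_Jval d (Om : measurableType d) (pi : Om -> policy R S A) :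
  (forall s a, measurable_fun setT (fun w => pi w s a : R)) ->
  measurable_fun setT (fun w => Jval M Rw k N (pi w) : R).
Proof.
move=> mpi.
(* Tonelli gives measurability of a parameter integral for a nonnegative integrand: hence the shift
   by [U] and the truncation at 0, which changes nothing on bounded batches. *)
pose f (z : Om * N.-tuple (reward R S A)) : R :=
  Num.max 0 (v0 M (pi z.1) (kworst_avg M k (pi z.1) z.2) + U).
have mpi1 s a : measurable_fun setT (fun z : Om * N.-tuple (reward R S A) => pi z.1 s a : R).
  exact: measurableT_comp (mpi s a) measurable_fst.
have mf : measurable_fun setT f.
  apply: measurable_maxr => //; apply: measurable_funD => //.
  by apply: measurable_v0 => //; apply: measurable_kworst => //; exact: measurable_snd.
have f0 z : (0 <= (f z)%:E)%E by rewrite lee_fin le_max lexx.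
have := @measurable_fun_fubini_tonelli_F _ _ Om _ R Q (EFin \o f)
  ((measurable_EFinP _ _).2 mf) f0.
move=> mF.
have -> : (fun w => Jval M Rw k N (pi w)) =
    (fun w => fine (fubini_F Q (EFin \o f) w) - U).
  apply/funext => w; rewrite JvalE.
  have ci : Q.-integrable setT (EFin \o cst U) by exact: finite_measure_integrable_cst.
  have vi := integrable_v0_kworst (pi w) (pi w).
  apply/eqP; rewrite eq_sym subr_eq; apply/eqP.
  have <- : \int[Q]_rs (v0 M (pi w) (kworst_avg M k (pi w) rs) + U) =
      \int[Q]_rs v0 M (pi w) (kworst_avg M k (pi w) rs) + U.
    rewrite (RintegralD measurableT vi ci) [X in _ + X]Rintegral_cst//.
    by rewrite [X in fine X]probability_setT mulr1.
  rewrite /fubini_F /Rintegral; congr fine.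
  apply: (as_eq_integral measurable_bounded_batch bounded_batch_prob).
  - apply/measurable_EFinP.
    exact: (measurableT_comp mf (pair1_measurable w)).
  - by apply/measurable_EFinP/measurable_funD => //; exact: measurable_v0_kworst.
  - move=> rs h; rewrite /f /=; congr _%:E; apply: max_idPr.
    by have := v0_kworst_bounded (pi w) (pi w) h; rewrite ler_norml => /andP[? _]; lra.
apply: (measurable_funB _ (measurable_cst _)).
exact: measurableT_comp mF.
Qed.

End robust_value.

(** * The gap supermartingale *)

Section learner_shift.
Variables (R : realType) (S A : finType) (M : mdp R S A).

(* The learners as they behave once each state [s] has observed [q s]: the
   first iteration can then be integrated out before the others. *)
Definition shift_learners (L : learners R S A) (q : S -> fun_space R A) :
    learners R S A :=
  fun s h => L s (q s :: h).

Lemma measurable_shift_learners L q :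
  measurable_learners L -> measurable_learners (shift_learners L q).
Proof.
move=> mL s a n.
have mc : measurable_fun setT
    (fun x : n.-tuple (fun_space R A) => [the n.+1.-tuple _ of q s :: x]).
  by apply: measurable_cons; [exact: measurable_cst|exact: measurable_id].
exact: (measurableT_comp (@mL s a n.+1) mc).
Qed.

Lemma cfr_historyS (L : learners R S A) (e : environment R S A) t s :
  cfr_history M L e t.+1 s =
  rcons (cfr_history M L e t s) (qval M (cfr M L e t) (e t (cfr M L e t)) s).
Proof. by []. Qed.

(** Histories grow at their end, whereas integrating out the first batch requires unrolling at the
    front: the first observation moves into the learners and the environment is shifted by one. *)
Lemma cfrS (L : learners R S A) (e : environment R S A) t :
  let pi1 : policy R S A := fun s => L s [::] in
  cfr M L e t.+1 =
  cfr M (shift_learners L (qval M pi1 (e 0%N pi1))) (fun t => e t.+1) t.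
Proof.
move=> pi1; set q := qval _ _ _; set e' := fun t => _.
have E t' : (forall s, cfr_history M L e t'.+1 s =
    q s :: cfr_history M (shift_learners L q) e' t' s) ->
    cfr M L e t'.+1 = cfr M (shift_learners L q) e' t'.
  by move=> H; apply/funext => s; rewrite /cfr H.
apply: (E); elim: t => [//|t IH] s.
by rewrite cfr_historyS IH (E _ IH) [in RHS]cfr_historyS.
Qed.

(** Policies up to index [T] see only the rewards revealed before [T]. This allows changing the
    environment beyond the horizon and replacing a sequence of batches by a tuple. *)
Lemma eq_cfr (L : learners R S A) (e e' : environment R S A) T :
  (forall t pi, (t < T)%N -> e t pi = e' t pi) ->
  forall t, (t <= T)%N -> cfr M L e t = cfr M L e' t.
Proof.
move=> ee'.
suff H : forall t, (t <= T)%N -> cfr_history M L e t = cfr_history M L e' t.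
  by move=> t tT; apply/funext => s; rewrite /cfr H.
elim=> [//|t IH] tT; apply/funext => s /=.
by rewrite (IH (ltnW tT)) ee'.
Qed.

End learner_shift.

Section gap_martingale.
Variables (R : realType) (S A : finType) (M : mdp R S A) (U : R).
Variable Rw : probability (reward R S A) R.
Hypothesis hRw : Rw (reward_bounded U) = 1%E.
Variables (k N : nat).
Hypothesis kN : (1 <= k <= N)%N.

Local Notation batch := (N.-tuple (reward R S A)).
Let Q : probability batch R := iid_law Rw N.

(** [kN_cfr] reads an infinite sequence of batches while the product law is on tuples. The default
    [point] beyond the end influences no policy of index at most the length. *)
Definition path (x : seq batch) (t : nat) : batch := nth point x t.

Lemma measurable_path n t : measurable_fun setT (fun x : n.-tuple batch => path x t).
Proof.
have [tn|nt] := ltnP t n.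
  have := @measurable_tnth _ batch n (Ordinal tn); congr measurable_fun.
  by apply/funext => x; rewrite (tnth_nth point).
have := @measurable_cst _ _ (n.-tuple batch) batch setT point; congr measurable_fun.
by apply/funext => x; rewrite /path nth_default// size_tuple.
Qed.

Lemma measurable_gap_noise d (Om : measurableType d) (pi : Om -> policy R S A)
    pi' (X : Om -> batch) :
  (forall s a, measurable_fun setT (fun w => pi w s a : R)) ->
  measurable_fun setT X ->
  measurable_fun setT (fun w => gap_noise M Rw k (pi w) pi' (X w)).
Proof.
move=> mpi mX; rewrite /gap_noise.
have mk := measurable_kworst M mpi k mX.
apply: measurable_funB.
  apply: (measurable_funB (measurable_cst _)).
  exact: (measurable_Jval M hRw kN mpi).
apply: measurable_funB; last exact: (measurable_v0 M mpi mk).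
apply: (measurable_v0 M (pi := fun=> pi')) mk => s a.
exact: measurable_cst.
Qed.

Definition noise_sum pi' (L : learners R S A) (x : seq batch) : R :=
  \sum_(t < size x) gap_noise M Rw k (kN_cfr M k L (path x) t) pi' (path x t).

Lemma noise_sum_cons pi' L b (x : seq batch) :
  let pi1 : policy R S A := fun s => L s [::] in
  noise_sum pi' L (b :: x) = gap_noise M Rw k pi1 pi' b +
    noise_sum pi' (shift_learners L (qval M pi1 (kworst_avg M k pi1 b))) x.
Proof.
move=> pi1; pose g t := gap_noise M Rw k (kN_cfr M k L (path (b :: x)) t) pi'
  (path (b :: x) t).
rewrite /noise_sum -/(\sum_(t < (size x).+1) g t) big_ord_recl.
apply: (congr1 (fun z => g 0%N + z)); apply: eq_bigr => t _.
by rewrite /g lift0 /kN_cfr cfrS.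
Qed.

Lemma measurable_kN_cfr_path L n t s a : measurable_learners L ->
  measurable_fun setT (fun x : n.-tuple batch => kN_cfr M k L (path x) t s a : R).
Proof.
move=> mL; exact: (measurable_kN_cfr M k mL (fun t => @measurable_path n t) t s a).
Qed.

Lemma measurable_noise_sum pi' L n : measurable_learners L ->
  measurable_fun setT (fun x : n.-tuple batch => noise_sum pi' L x).
Proof.
move=> mL.
rewrite (_ : (fun _ => _) = (fun x : n.-tuple batch => \sum_(t < n)
   gap_noise M Rw k (kN_cfr M k L (path x) t) pi' (path x t))); last first.
  by apply/funext => x; rewrite /noise_sum size_tuple.
apply: measurable_sum => t; apply: measurable_gap_noise => [s a|].
  exact: measurable_kN_cfr_path.
exact: measurable_path.
Qed.

(** Induction for all learners at once: given the first batch [b], the remaining sum is the same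
    problem for shifted learners. Its bound does not depend on [b], so it factors out of the outer
    integral. *)
Lemma noise_sum_mgf pi' n L (th : R) : measurable_learners L -> 0 <= th ->
  (\int[iid_law Q n]_x (expR (th * noise_sum pi' L x))%:E <=
    (expR (n%:R * (th ^+ 2 * (4 * U) ^+ 2 / 2)))%:E)%E.
Proof.
move=> mL th0; set v := th ^+ 2 * (4 * U) ^+ 2 / 2.
have mexp m L' : measurable_learners L' -> measurable_fun setT
    (fun x : m.-tuple batch => (expR (th * noise_sum pi' L' x))%:E).
  move=> mL'; apply/measurable_EFinP; apply: measurableT_comp => //.
  by apply: measurable_funM => //; exact: measurable_noise_sum.
elim: n L mL => [|n IH] L mL.
  rewrite /= integral_dirac//; last exact: mexp.
  by rewrite diracE mem_set// mul1e /noise_sum big_ord0 mulr0 mul0r.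
rewrite [X in (\int[X]_x _)%E]/=.
rewrite ge0_integral_distribution//; last exact: mexp.
have mcons : measurable_fun setT
    (fun z : batch * n.-tuple batch => (expR (th * noise_sum pi' L (z.1 :: z.2)))%:E).
  exact: (measurableT_comp (mexp _ _ mL) (@measurable_tuple_cons _ batch n)).
have cons0 (z : batch * n.-tuple batch) :
  (0 <= (expR (th * noise_sum pi' L (z.1 :: z.2)))%:E)%E by rewrite lee_fin expR_ge0.
have := @fubini_tonelli1 _ _ _ _ _ Q (iid_law Q n) _ mcons cons0.
rewrite /fubini_F /= => ->.
have mfub := @measurable_fun_fubini_tonelli_F _ _ _ _ _ (iid_law Q n) _ mcons cons0.
pose pi1 : policy R S A := fun s => L s [::].
pose F (b : batch) := (expR (th * gap_noise M Rw k pi1 pi' b))%:E.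
have F0 (b : batch) : (0 <= F b)%E by rewrite lee_fin expR_ge0.
have mF : measurable_fun setT F.
  apply/measurable_EFinP; apply: measurableT_comp => //; apply: measurable_funM => //.
  apply: (@measurable_gap_noise _ _ (fun=> pi1)) => [s a|].
    exact: measurable_cst.
  exact: measurable_id.
apply: (@le_trans _ _ (\int[Q]_b (F b * (expR (n%:R * v))%:E))%E).
  apply: ge0_le_integral => //.
  - by move=> b _; apply: integral_ge0 => x _; exact: (cons0 (b, x)).
  - exact: emeasurable_funM.
  - move=> b _.
    pose L' := shift_learners L (qval M pi1 (kworst_avg M k pi1 b)).
    have mL' : measurable_learners L' by exact: measurable_shift_learners.
    rewrite (eq_integral (fun x : n.-tuple batch =>
      (F b * (expR (th * noise_sum pi' L' x))%:E)%E)); last first.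
      by move=> x _; rewrite noise_sum_cons mulrDr expRD EFinM.
    rewrite ge0_integralZl//; last exact: mexp.
    by apply: lee_wpmul2l => //; exact: IH.
rewrite ge0_integralZr// ?lee_fin ?expR_ge0//.
rewrite -natr1 mulrDl mul1r addrC expRD EFinM.
apply: lee_wpmul2r; first by rewrite lee_fin expR_ge0.
exact: (gap_noise_mgf M hRw kN pi1 pi' th0).
Qed.

End gap_martingale.

Lemma count_markov (R : realType) (T : nat) (g : 'I_T -> R) (eps q : R) :
  (0 < T)%N -> (forall i, 0 <= g i) -> \sum_i g i <= T%:R * eps -> 0 < q ->
  (1 - q) * T%:R <= \sum_(i < T) (g i <= eps / q)%R%:R.
Proof.
move=> T0 g0 gs q0.
have Tp : 0 < T%:R :> R by rewrite ltr0n.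
have eps0 : 0 <= eps.
  by rewrite -(pmulr_rge0 _ Tp); apply: le_trans gs; exact: sumr_ge0.
(* The weight [q / eps] used below needs [eps > 0]; when [eps = 0] every [g i] vanishes. *)
have [eps1|eps1] := ltP 0 eps; last first.
  have e0 : eps = 0 by apply/le_anti; rewrite eps1.
  have gi i : g i = 0.
    apply/le_anti; rewrite g0 andbT; apply: le_trans (_ : \sum_i g i <= 0).
      by rewrite (bigD1 i)//= lerDl sumr_ge0.
    by rewrite (le_trans gs)// e0 mulr0.
  rewrite (eq_bigr (fun=> 1)) => [|i _]; last by rewrite gi e0 mul0r lexx.
  by rewrite sumr_const card_ord ler_piMl// gerBl ltW.
rewrite mulrBl mul1r lerBlDr -lerBlDl.
(* Markov's inequality term by term: an index with [g i > eps / q] contributes at least 1 to this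
   sum. *)
apply: (@le_trans _ _ (\sum_i g i * (q / eps))).
  have -> : T%:R = \sum_(i < T) (1 : R) by rewrite sumr_const card_ord.
  rewrite -sumrB; apply: ler_sum => i _.
  have qe : 0 < q / eps by exact: divr_gt0.
  have [h|h] := leP (g i) (eps / q); rewrite /= ?mulr1n ?mulr0n.
    by rewrite subrr mulr_ge0// ltW.
  by rewrite subr0 -ler_pdivrMr// invf_div mul1r ltW.
rewrite -mulr_suml -ler_pdivlMr; last exact: divr_gt0.
apply: le_trans gs _; rewrite le_eqVlt; apply/orP; left; apply/eqP; field.
by rewrite !lt0r_neq0.
Qed.

(** * Tail bound for the total gap *)

Section gap.
Variables (R : realType) (S A : finType) (M : mdp R S A) (U : R).
Variable Rw : probability (reward R S A) R.
Hypothesis hRw : Rw (reward_bounded U) = 1%E.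
Variables (k N T : nat).
Hypothesis kN : (1 <= k <= N)%N.
Hypothesis T1 : (1 <= T)%N.
Variable L : learners R S A.
Hypothesis mL : measurable_learners L.
Variable C : nat -> R.
Hypothesis hC : cfr_regret_bound M U L C.

Local Notation batch := (N.-tuple (reward R S A)).
Local Notation J := (Jval M Rw k N).
Local Notation vstar := (v_star M Rw k N).
Let Q : probability batch R := iid_law Rw N.
Let Lam : probability (T.-tuple batch) R := iid_law Q T.

Let pit (x : T.-tuple batch) (t : nat) := kN_cfr M k L (path x) t.

Let U0 : 0 <= U.
Proof.
have := Jval_bounded M hRw kN (fun s => L s [::]).
exact: le_trans (normr_ge0 _).
Qed.

Lemma Jval_has_sup : has_sup [set J pi | pi in [set: policy R S A]].
Proof.
split; first by exists (J (fun s => L s [::])), (fun s => L s [::]).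
exists U => _ [pi _ <-]; apply: le_trans (ler_norm _) _.
exact: (Jval_bounded M hRw kN).
Qed.

Lemma Jval_le_v_star pi : J pi <= vstar.
Proof. by apply: ub_le_sup; [exact: Jval_has_sup.2|exists pi]. Qed.

Let good : set (T.-tuple batch) :=
  [set x | forall t, bounded_batch U (tnth x t)].

Let mgood : measurable good.
Proof. exact: (measurable_rectangle (fun=> @measurable_bounded_batch R S A U N)). Qed.

Let good1 : Lam good = 1%E.
Proof.
exact: (iid_law_all1 T (@measurable_bounded_batch R S A U N) (bounded_batch_prob hRw N)).
Qed.

Lemma sampled_regret_le x pi' : good x ->
  \sum_(t < T) (v0 M pi' (kworst_avg M k (pit x t) (path x t)) -
                v0 M (pit x t) (kworst_avg M k (pit x t) (path x t)))
  <= C T / (1 - gamma M).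
Proof.
move=> gx.
(* The regret bound asks for bounded rewards at every iteration and for every policy; from [T] on
   the default batch carries no bound, so the zero reward replaces it. *)
pose e t pi : reward R S A :=
  if (t < T)%N then kworst_avg M k pi (path x t) else fun=> 0.
have be t pi : reward_bounded U (e t pi).
  rewrite /e; case: ltnP => tT; last by move=> z; rewrite normr0.
  apply: kworst_bounded => // j; have := gx (Ordinal tT) j.
  by rewrite (tnth_nth point x).
have [_ /(_ e be T T1) hreg] := hC.
have E t : (t < T)%N -> cfr M L e t = pit x t.
  move=> tT; apply: (@eq_cfr _ _ _ M L _ _ T); last exact: ltnW.
  by move=> t' pi t'T; rewrite /e t'T.
apply: (regret_le (pi := pit x) (r := fun t => kworst_avg M k (pit x t) (path x t))).
move=> s a; apply: le_trans (hreg s a); rewrite le_eqVlt; apply/orP; left; apply/eqP.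
by apply: eq_bigr => t _; rewrite E ?ltn_ord// /e ltn_ord.
Qed.

Let K (x : T.-tuple batch) : R := \sum_(t < T) J (pit x t).

Let mJ t : measurable_fun setT (fun x => J (pit x t) : R).
Proof.
apply: (measurable_Jval M hRw kN) => s a; exact: measurable_kN_cfr_path.
Qed.

Let mK : measurable_fun setT K.
Proof. by apply: measurable_sum => t; exact: mJ. Qed.

Let K_bounded x : `|K x| <= T%:R * U.
Proof.
apply: le_trans (ler_norm_sum _ _ _) _.
rewrite mulr_natl -[X in _ *+ X]card_ord -sumr_const; apply: ler_sum => t _.
exact: (Jval_bounded M hRw kN).
Qed.

Let gap_le_noise x pi' : good x ->
  T%:R * J pi' - K x <= noise_sum M Rw k pi' L x + C T / (1 - gamma M).
Proof.
move=> gx.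
have -> : noise_sum M Rw k pi' L x =
    \sum_(t < T) gap_noise M Rw k (pit x t) pi' (path x t).
  by rewrite /noise_sum size_tuple.
have -> : T%:R * J pi' - K x = \sum_(t < T) (J pi' - J (pit x t)).
  by rewrite mulr_natl sumrB sumr_const card_ord.
rewrite -lerBlDl -sumrB; apply: le_trans (sampled_regret_le pi' gx).
apply: ler_sum => t _; rewrite /gap_noise -/(pit x t).
by rewrite opprB addrC subrK.
Qed.

(** The left-hand side is free of [pi']: only the deterministic [J pi'] was moved across, so the
    bound can be optimized over [pi'] afterwards. *)
Let mgf_K (th : R) pi' : 0 <= th ->
  (\int[Lam]_x (expR (- (th * K x)))%:E <=
    (expR (th * (C T / (1 - gamma M)) + T%:R * (th ^+ 2 * (4 * U) ^+ 2 / 2) -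
       th * (T%:R * J pi')))%:E)%E.
Proof.
move=> th0; set c := C T / (1 - gamma M).
pose a := expR (th * c - th * (T%:R * J pi')).
have mn : measurable_fun setT
    (fun x : T.-tuple batch => (expR (th * noise_sum M Rw k pi' L x))%:E).
  apply/measurable_EFinP; apply: measurableT_comp => //.
  apply: measurable_funM => //.
  exact: (@measurable_noise_sum _ _ _ M U Rw hRw k N kN pi' L T mL).
have mE : measurable_fun setT (fun x : T.-tuple batch => (expR (- (th * K x)))%:E).
  apply/measurable_EFinP; apply: measurableT_comp => //.
  by apply: measurableT_comp => //; exact: measurable_funM.
apply: (@le_trans _ _ (\int[Lam]_x (a%:E * (expR (th * noise_sum M Rw k pi' L x))%:E))%E).
  apply: ae_ge0_le_integral => //.
  - by move=> x _; rewrite -EFinM lee_fin mulr_ge0 // expR_ge0.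
  - exact: measurable_funeM mn.
  - exists (~` good); split; [exact: measurableC| |].
      have : Lam (~` good) = 0%E by rewrite probability_setC// good1 subee.
      exact.
    move=> x /= h gx; apply: h => _; rewrite -EFinM lee_fin -expRD ler_expR.
    have := ler_wpM2l th0 (gap_le_noise pi' gx); rewrite -/c !mulrDr mulrN.
    move: (th * _) (th * _) (th * _) (th * _) => u1 u2 u3 u4; lra.
rewrite ge0_integralZl//; last by rewrite lee_fin expR_ge0.
apply: (@le_trans _ _ (a%:E * (expR (T%:R * (th ^+ 2 * (4 * U) ^+ 2 / 2)))%:E)%E).
  apply: lee_wpmul2l; first by rewrite lee_fin expR_ge0.
  exact: (@noise_sum_mgf _ _ _ M U Rw hRw k N kN pi' T L th mL th0).
by rewrite -EFinM -expRD addrAC.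
Qed.

Let mgf_K_sup (th : R) : 0 < th ->
  (\int[Lam]_x (expR (- (th * K x)))%:E <=
    (expR (th * (C T / (1 - gamma M)) + T%:R * (th ^+ 2 * (4 * U) ^+ 2 / 2) -
       th * (T%:R * vstar)))%:E)%E.
Proof.
move=> th0; set b := th * _ + _.
have Tp : 0 < th * T%:R by rewrite mulr_gt0// ltr0n.
set I := (\int[Lam]_x _)%E.
have Ile pi : (I <= (expR (b - th * (T%:R * J pi)))%:E)%E by exact: mgf_K (ltW th0).
(* A positive lower bound on the integral makes its logarithm usable; the inequality can then be
   solved for [J pi] and the supremum taken. *)
have Ige : ((expR (- (th * (T%:R * U))))%:E <= I)%E.
  rewrite -[leLHS]mule1 -[X in (_ * X <= _)%E](@probability_setT _ _ _ Lam).
  rewrite -integral_cst//; apply: ge0_le_integral => //.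
  - by move=> x _; rewrite lee_fin expR_ge0.
  - apply/measurable_EFinP; apply: measurableT_comp => //.
    by apply: measurableT_comp => //; exact: measurable_funM.
  - move=> x _; rewrite lee_fin ler_expR lerN2 ler_wpM2l ?(ltW th0)//.
    exact: le_trans (ler_norm _) (K_bounded x).
have Ifin : I \is a fin_num.
  rewrite ge0_fin_numE ?(le_lt_trans (Ile (fun s => L s [::]))) ?ltry//.
  by apply: le_trans Ige; rewrite lee_fin expR_ge0.
move: Ile Ige; rewrite -(fineK Ifin); move: (fine I) => i Ile.
rewrite lee_fin => /(lt_le_trans (expR_gt0 _)) i0.
have lnIle pi : ln i <= b - th * (T%:R * J pi).
  by have := Ile pi; rewrite lee_fin -[leLHS]lnK ?posrE// ler_expR.
rewrite lee_fin -[leLHS]lnK ?posrE// ler_expR.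
have : vstar <= (b - ln i) / (th * T%:R).
  apply: sup_le_ub; first exact: Jval_has_sup.1.
  move=> _ [pi _ <-]; rewrite ler_pdivlMr//.
  by have := lnIle pi; rewrite [J pi * _]mulrC -mulrA !lerBrDr addrC.
by rewrite ler_pdivlMr// [vstar * _]mulrC -mulrA !lerBrDr addrC.
Qed.

Lemma gap_tail (p : R) : 0 < p <= 1 ->
  (Lam [set x | (T%:R * eps_bound (gamma M) U p (C T) T <
    \sum_(t < T) (vstar - J (pit x t)))%R] <= p%:E)%E.
Proof.
move=> /andP[p0 p1].
have E x : \sum_(t < T) (vstar - J (pit x t)) = T%:R * vstar - K x.
  by rewrite mulr_natl sumrB sumr_const card_ord.
rewrite (_ : [set _ | _] =
  [set x | T%:R * eps_bound (gamma M) U p (C T) T < T%:R * vstar - K x]); last first.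
  by apply/seteqP; split=> x /=; rewrite E.
set c := C T / (1 - gamma M).
set s := Num.sqrt (2 * ln (1 / p) / T%:R).
have Tp : 0 < T%:R :> R by rewrite ltr0n.
have g1 : 1 - gamma M != 0.
  by have /andP[_ h] := gamma_range M; rewrite subr_eq0 eq_sym lt_eqF.
have -> : T%:R * eps_bound (gamma M) U p (C T) T = c + 4 * U * T%:R * s.
  rewrite /eps_bound -/s /c; field.
  by rewrite g1 lt0r_neq0.
set bad := [set x | _].
have mbad : measurable bad.
  have := measurable_fun_ltr (measurable_cst (c + 4 * U * T%:R * s))
    (measurable_funB (measurable_cst (T%:R * vstar)) mK).
  by move=> /(_ measurableT [set true] I); rewrite setTI.
have [p1'|p1'] := ltP p 1; last first.
  by rewrite (le_trans (probability_le1 Lam mbad))// lee_fin.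
(* The parameter [th] below divides by [4 * U]. If [U = 0], all returns on bounded batches and all
   values of [J] are zero, and the regret bound forces [c >= 0]. *)
have [Up|U00] := ltP 0 U; last first.
  have U0' : U = 0 by apply/le_anti; rewrite U0 U00.
  rewrite (_ : bad = set0) ?measure0 ?lee_fin ?ltW//.
  apply/seteqP; split=> // x; rewrite /bad /= U0' mulr0 !mul0r addr0.
  have J0 pi : J pi = 0.
    by apply/eqP; rewrite -normr_le0 -U0'; exact: (Jval_bounded M hRw kN).
  have [y gy] : good !=set0.
    by apply/set0P/eqP => h; have := good1; rewrite h measure0 => /eqP;
      rewrite eq_sym onee_eq0.
  have v00 pi pi' (b : batch) : bounded_batch U b -> v0 M pi (kworst_avg M k pi' b) = 0.
    move=> hb; have := v0_kworst_bounded M kN pi pi' hb.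
    by rewrite U0' normr_le0 => /eqP.
  have c0 : 0 <= c.
    apply: le_trans (sampled_regret_le (fun s => L s [::]) gy).
    rewrite big1// => t _; have := gy t; rewrite (tnth_nth point) => gyt.
    by rewrite !v00// subrr.
  have vs : vstar <= 0.
    rewrite -U0'; apply: sup_le_ub; first exact: Jval_has_sup.1.
    by move=> _ [pi _ <-]; rewrite J0 U0'.
  have -> : K x = 0 by rewrite /K big1.
  rewrite subr0 => /(le_lt_trans c0); rewrite ltNge => /negP; apply.
  by rewrite mulr_ge0_le0.
have l0 : 0 < ln (1 / p) by rewrite ln_gt0// div1r invf_gt1.
have s0 : 0 < s by rewrite sqrtr_gt0 divr_gt0// mulr_gt0.
have s2 : s ^+ 2 = 2 * ln (1 / p) / T%:R by rewrite sqr_sqrtr// ltW// divr_gt0// mulr_gt0.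
(* The minimizer of the Chernoff exponent [- th * 4 * U * T * s + T * th ^ 2 * (4 * U) ^ 2 / 2],
   whose minimum [- T * s ^ 2 / 2] equals [ln p]. *)
pose th := s / (4 * U).
have th0 : 0 < th by rewrite divr_gt0// mulr_gt0.
pose lo := expR (th * (c + 4 * U * T%:R * s) - th * (T%:R * vstar)).
have : (lo%:E * Lam bad <= \int[Lam]_x (expR (- (th * K x)))%:E)%E.
  rewrite -[X in (_ * Lam X)%E]setIT -integral_indic// -ge0_integralZl//; last 2 first.
  + by apply/measurable_EFinP; exact: measurable_indic.
  + by rewrite lee_fin expR_ge0.
  apply: ge0_le_integral => //.
  - by move=> x _; rewrite -EFinM lee_fin mulr_ge0 ?expR_ge0.
  - apply: measurable_funeM; apply/measurable_EFinP; exact: measurable_indic.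
  - apply/measurable_EFinP; apply: measurableT_comp => //.
    by apply: measurableT_comp => //; exact: measurable_funM.
  - move=> x _; rewrite -EFinM lee_fin indicE.
    have [/set_mem|_] := boolP (x \in bad); last by rewrite mulr0 expR_ge0.
    rewrite mulr1 /bad /= => h; rewrite ler_expR.
    have := ler_wpM2l (ltW th0) (ltW h); rewrite [leRHS]mulrBr.
    by move: (th * _) (th * _) (th * _) => u1 u2 u3; lra.
move=> /le_trans/(_ (mgf_K_sup th0)).
rewrite -/c muleC -lee_pdivlMr ?expR_gt0// -EFinM => /le_trans; apply.
rewrite lee_fin -expRN -expRD -[leRHS]lnK ?posrE// ler_expR.
have -> : ln p = - (T%:R * s ^+ 2 / 2).
  rewrite s2 div1r lnV ?posrE//; field; exact: lt0r_neq0.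
rewrite le_eqVlt; apply/orP; left; apply/eqP; rewrite /th; field.
exact: lt0r_neq0.
Qed.

End gap.

(** [count_markov] integrated over the sample: the average of the [T] probabilities is the mean
    fraction of good indices, which is at least [1 - q] on [F]. *)
Lemma count_markov_measure d (X : measurableType d) (R : realType)
    (P : probability X R) (T : nat) (g : 'I_T -> X -> R) (eps q : R) :
  (0 < T)%N -> (forall i, measurable_fun setT (g i)) -> (forall i x, 0 <= g i x) ->
  0 < q -> q <= 1 ->
  ((1 - q)%:E * P [set x | (\sum_i g i x <= T%:R * eps)%R] <=
    \sum_(i < T) (T%:R^-1)%:E * P [set x | (g i x <= eps / q)%R])%E.
Proof.
move=> hT mg g0 q0 q1; have T0 : 0 < T%:R :> R by rewrite ltr0n.
set F := [set x | _]; pose G i := [set x | g i x <= eps / q].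
have mle (f : X -> R) c : measurable_fun setT f -> measurable [set x | f x <= c].
  move=> mf; have := measurable_fun_ler mf (measurable_cst c).
  by move=> /(_ measurableT [set true] I); rewrite setTI.
have mF : measurable F by apply: mle; exact: measurable_sum.
have mG i : measurable (G i) by exact: mle.
have mI (B : set X) : measurable B -> measurable_fun setT (fun x => (\1_B x : R)%:E).
  by move=> mB; apply/measurable_EFinP; exact: measurable_indic.
have -> : (\sum_(i < T) (T%:R^-1)%:E * P [set x | (g i x <= eps / q)%R] =
    \int[P]_x (\sum_(i < T) (T%:R^-1)%:E * (\1_(G i) x)%:E))%E.
  rewrite ge0_integral_sum//.
  - apply: eq_bigr => i _; rewrite ge0_integralZl//; last exact: mI.
    by rewrite integral_indic// setIT.
  - by move=> i; apply: measurable_funeM; exact: mI.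
apply: (@le_trans _ _ (\int[P]_x ((1 - q)%:E * (\1_F x)%:E))%E).
  rewrite ge0_integralZl//; first by rewrite integral_indic// setIT.
  - exact: mI.
  - by rewrite lee_fin subr_ge0.
apply: ge0_le_integral => //.
- by move=> x _; rewrite mule_ge0// lee_fin ?subr_ge0.
- by apply: measurable_funeM; exact: mI.
- by apply: emeasurable_sum => i; apply: measurable_funeM; exact: mI.
move=> x _; under eq_bigr do rewrite -EFinM.
rewrite sumEFin -EFinM lee_fin -mulr_sumr.
have [/set_mem Fx|xF] := boolP (x \in F); last first.
  by rewrite indicE (negbTE xF) mulr0 mulr_ge0 ?invr_ge0 ?(ltW T0)// sumr_ge0.
rewrite indicE mem_set// mulr1 ler_pdivlMl// mulrC.
apply: le_trans (count_markov hT (g0 ^~ x) Fx q0) _.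
apply: ler_sum => i _; rewrite indicE ler_nat.
have [h|//] := leP (g i x) (eps / q).
by rewrite (mem_set (h : G i x)).
Qed.

(** * From the sample space to the product law *)

Section sample_law.
Variables (R : realType) (S A : finType).
Variables (Rw : probability (reward R S A) R) (N T : nat).
Context d (Om : measurableType d) (P : probability Om R).
Variable X : nat -> Om -> N.-tuple (reward R S A).
Hypothesis hX : iid_samples Rw T P X.

Local Notation batch := (N.-tuple (reward R S A)).

Definition sample_tuple (w : Om) : T.-tuple batch := [tuple X t w | t < T].

Lemma measurable_sample_tuple : measurable_fun setT sample_tuple.
Proof.
have [mX _] := hX.
apply/measurable_fun_tnthP => t; apply/measurable_fun_tnthP => j.
have := mX t j; congr measurable_fun.
by apply/funext => w /=; rewrite tnth_mktuple.
Qed.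

(** Used with [D = setT], [c = 1] for the best policy, and with [D] the event [tau = i], [c = 1 / T]
    for the random index; independence is assumed on rectangles only and extended here to all
    events. *)
Lemma sample_tuple_law (D : set Om) (c : R) : measurable D -> 0 <= c ->
  (forall B : 'I_T -> 'I_N -> set (reward R S A),
    (forall t j, measurable (B t j)) ->
    P (D `&` sample_event X B) = (c%:E * P (sample_event X B))%E) ->
  forall E, measurable E ->
    P (D `&` sample_tuple @^-1` E) = (c%:E * iid_law (iid_law Rw N) T E)%E.
Proof.
move=> mD c0 hD E mE.
pose Xm := isMeasurableFun.Build _ _ _ _ sample_tuple measurable_sample_tuple.
pose Xf : {mfun Om >-> T.-tuple batch} := HB.pack sample_tuple Xm.
rewrite (setIC D).
apply: (@iid_law2_unique _ _ R Rw T N c (pushforward (mrestr P mD) Xf)) => // B mB.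
rewrite -hX.2// -hD// setIC; congr (P (_ `&` _)).
by apply/seteqP; split=> w h t j; have := h t j; rewrite /= tnth_mktuple.
Qed.

Lemma kN_cfr_sample_tuple (M : mdp R S A) k (L : learners R S A) w t :
  (t < T)%N -> kN_cfr M k L (X ^~ w) t = kN_cfr M k L (path (sample_tuple w)) t.
Proof.
move=> tT; apply: (@eq_cfr _ _ _ M L _ _ T); last exact: ltnW.
move=> t' pi t'T; congr (kworst_avg M k pi _).
by rewrite /path -(tnth_nth point _ (Ordinal t'T)) tnth_mktuple.
Qed.

End sample_law.

Theorem theorem3 (R : realType) (S A : finType) (M : mdp R S A) (U : R)
    (Rw : probability (reward R S A) R)
    (hRw : Rw (reward_bounded U) = 1%E)
    (k N T : nat) (hk : (1 <= k <= N)%N) (hT : (1 <= T)%N)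
    (L : learners R S A) (hL : measurable_learners L)
    (C : nat -> R) (hC : cfr_regret_bound M U L C)
    (d : measure_display) (Om : measurableType d) (P : probability Om R)
    (X : nat -> Om -> N.-tuple (reward R S A))
    (hX : iid_samples Rw T P X)
    (p : R) (hp : 0 < p <= 1) :
  let pi (t : nat) (w : Om) : policy R S A := kN_cfr M k L (X ^~ w) t in
  let J : policy R S A -> R := Jval M Rw k N in
  let eps := eps_bound (gamma M) U p (C T) T in
  with_prob_ge P (1 - p)
    [set w | forall t : 'I_T,
       (forall t' : 'I_T, J (pi t' w) <= J (pi t w)) ->
       approx_robust M Rw k N eps (pi t w)]
  /\
  (forall (q : R) (tau : Om -> 'I_T),
     0 < q <= 1 -> independent_uniform_index P X tau ->
     with_prob_ge P ((1 - p) * (1 - q))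
       [set w | approx_robust M Rw k N (eps / q) (pi (tau w) w)]).
Proof.
move=> pi J eps.
pose Xs := sample_tuple T X.
have mXs : measurable_fun setT Xs by exact: (measurable_sample_tuple hX).
pose Lam : probability (T.-tuple (N.-tuple (reward R S A))) R :=
  iid_law (iid_law Rw N) T.
pose JT (t : 'I_T) (x : T.-tuple (N.-tuple (reward R S A))) : R :=
  J (kN_cfr M k L (path x) t).
have JE (t : 'I_T) w : J (pi t w) = JT t (Xs w).
  by rewrite /JT /pi (kN_cfr_sample_tuple X M k L w (ltn_ord t)).
have mJT t : measurable_fun setT (JT t).
  by apply: (measurable_Jval M hRw hk) => s a; exact: measurable_kN_cfr_path.
have mJ (t : 'I_T) : measurable_fun setT (fun w => J (pi t w)).
  rewrite (_ : (fun _ => _) = JT t \o Xs); first exact: measurableT_comp.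
  by apply/funext => w; rewrite JE.
have mge (c : R) (t : 'I_T) : measurable [set w | c <= J (pi t w)].
  have := measurable_fun_ler (measurable_cst c) (mJ t).
  by move=> /(_ measurableT [set true] I); rewrite setTI.
have mgeT (c : R) (t : 'I_T) : measurable [set x | c <= JT t x].
  have := measurable_fun_ler (measurable_cst c) (mJT t).
  by move=> /(_ measurableT [set true] I); rewrite setTI.
pose vs := v_star M Rw k N.
pose F := [set x | \sum_(t < T) (vs - JT t x) <= T%:R * eps].
have mF : measurable F.
  have ms : measurable_fun setT (fun x => \sum_(t < T) (vs - JT t x)).
    apply: measurable_sum => t; exact: (measurable_funB (measurable_cst vs) (mJT t)).
  have := measurable_fun_ler ms (measurable_cst (T%:R * eps)).
  by move=> /(_ measurableT [set true] I); rewrite setTI.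
have LF : ((1 - p)%:E <= Lam F)%E.
  have := gap_tail hRw hk hT hL hC hp.
  rewrite (_ : [set _ | _] = ~` F); last first.
    by apply/seteqP; split=> x /=; rewrite ltNge => /negP.
  change (Lam (~` F) <= p%:E -> (1 - p)%:E <= Lam F)%E.
  by rewrite probability_setC// EFinB leeBlDr ?fin_num_measure// leeBlDl.
have vJ t x : 0 <= vs - JT t x.
  by rewrite subr_ge0; exact: (Jval_le_v_star M hRw hk L).
have T0 : 0 < T%:R :> R by rewrite ltr0n.
split.
- set E := [set w | _].
  have mE : measurable E.
    (* The universally quantified implication becomes a finite intersection of events: either [t] is
       not a maximizer, or its policy is good enough. *)
    rewrite (_ : E = \big[setI/setT]_(t < T)
      (~` (\big[setI/setT]_(t' < T) [set w | J (pi t' w) <= J (pi t w)])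
       `|` [set w | vs - eps <= J (pi t w)])).
      apply: bigsetI_measurable => t _; apply: measurableU => //.
      apply: measurableC; apply: bigsetI_measurable => t' _.
      have := measurable_fun_ler (mJ t') (mJ t).
      by move=> /(_ measurableT [set true] I); rewrite setTI.
    rewrite -bigcap_seq; apply/seteqP; split=> w /= h t.
      move=> _; rewrite -bigcap_seq /=.
      have [best|nbest] := pselect (forall t' : 'I_T, J (pi t' w) <= J (pi t w)).
        by right; exact: h.
      by left => b; apply: nbest => t'; apply: b; rewrite /= mem_index_enum.
    move=> best; have := h t; rewrite /= mem_index_enum => /(_ isT).
    by rewrite -bigcap_seq => -[[]|//] t' _; exact: best.
  split=> //.
    have := sample_tuple_law hX measurableT ler01.
    move=> /(_ _ F mF); rewrite setTI mul1e => PF.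
    apply: le_trans LF _; rewrite -PF; last first.
      by move=> B mB; rewrite setTI mul1e.
    have mFX : measurable (Xs @^-1` F).
      by rewrite -[X in measurable X]setTI; exact: mXs.
    apply: le_measure; rewrite ?inE//.
    move=> w /=; rewrite /F /= => h t best.
    rewrite /approx_robust lerBlDl -lerBlDr -/(J (pi t w)).
    (* The gap at a maximizer is the smallest one, so [T] times it is at most the total gap. *)
    rewrite -(ler_pM2l T0); apply: le_trans h.
    rewrite mulr_natl -[X in _ *+ X]card_ord -sumr_const; apply: ler_sum => t' _.
    by rewrite lerD2l lerN2 -JE; exact: best.
move=> q tau /andP[q0 q1] [mtau tauU tauI].
pose G (i : 'I_T) := [set x | vs - eps / q <= JT i x].
have mG i : measurable (G i) by exact: mgeT.
set E := [set w | _].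
have mE : measurable E.
  have mb (i : 'I_T) : measurable_fun setT (fun w => vs - eps / q <= J (pi i w)).
    exact: (measurable_fun_ler (measurable_cst _) (mJ i)).
  have := measurable_fun_finite_case mtau mb.
  by move=> /(_ measurableT [set true] I); rewrite setTI.
split=> //.
have Tinv0 : 0 <= T%:R^-1 :> R by rewrite invr_ge0 ltW.
have EG w i : tau w = i -> E w = G i (Xs w).
  move=> e; rewrite -[E w]/(is_true (vs - eps / q <= J (pi (tau w) w))) e JE.
  by [].
(* Splitting over the value of [tau]: on [tau = i] the event concerns the fixed index [i], and
   independence yields the factor [1 / T]. *)
have -> : P E = (\sum_(i < T) (T%:R^-1)%:E * Lam (G i))%E.
  rewrite (measure_finite_partition mtau P mE); apply: eq_bigr => i _.
  have -> : E `&` [set w | tau w = i] = [set w | tau w = i] `&` Xs @^-1` G i.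
    apply/seteqP; split=> w [h1 h2].
      by split; [exact: h2|rewrite /preimage /mkset -(EG w i h2); exact: h1].
    by split; [rewrite (EG w i h1); exact: h2|exact: h1].
  apply: (sample_tuple_law hX (mtau i) Tinv0 _ (mG i)) => B mB.
  by rewrite tauI// tauU.
(* The product [(1 - p) * (1 - q)]: the total gap is small with probability at least [1 - p], and on
   that event at least a fraction [1 - q] of the indices is good. *)
apply: (@le_trans _ _ ((1 - q)%:E * Lam F)%E).
  by rewrite mulrC EFinM lee_wpmul2l// lee_fin subr_ge0.
have := @count_markov_measure _ _ R Lam T (fun t x => vs - JT t x) eps q hT
  (fun t => measurable_funB (measurable_cst vs) (mJT t)) vJ q0 q1.
move=> /le_trans; apply; rewrite le_eqVlt; apply/orP; left; apply/eqP.
apply: eq_bigr => i _; apply: (congr1 (fun B => (T%:R^-1)%:E * Lam B)%E).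
by apply/seteqP; split=> x; rewrite /G /mkset lerBlDr -lerBlDl.
Qed.
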